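(* (a) Let $E$ be a Banach space that is not polynomially Schur. Then the set of $E$-valued sequences that are polynomially null and not norm null is spaceable in $c_0^w(E)$. (b) Let $E$ be a Banach lattice failing the positive Schur property. Then the set of $E$-valued sequences that are disjoint, weakly null and not norm null is completely latticeable in $\ell_\infty(E)$. (c) Let $E$ be a Banach lattice that is not positively polynomially Schur. Then the set of $E$-valued sequences that are disjoint, regular-polynomially null and not norm null is completely latticeable in $\ell_\infty(E)$.
   Context: Sequence spaces. For a Banach space $E$, $\ell_\infty(E)$ is the Banach space of bounded $E$-valued sequences with the sup norm, and $c_0^w(E)$ is its closed subspace of weakly null sequences. If $E$ is a Banach lattice, $\ell_\infty(E)$ is a Banach lattice with the coordinatewise order. Spaceability and latticeability. A subset $A$ of a topological vector space $X$ is spaceable in $X$ if there is a closed infinite dimensional subspace of $X$ all of whose elements but the origin belong to $A$. A subset $A$ of a Banach lattice $X$ is completely latticeable in $X$ if there is a closed infinite dimensional sublattice (linear sublattice, i.e. Riesz subspace) of $X$ all of whose elements but the origin belong to $A$. Polynomials. All homogeneous polynomials have degree $n\in\mathbb{N}=\{1,2,\dots\}$. For a Banach lattice $E$, a scalar-valued $n$-homogeneous polynomial on $E$ is positive if its associated symmetric $n$-linear form takes nonnegative values on $n$-tuples of positive vectors; it is regular if it is a difference of two positive $n$-homogeneous polynomials. A sequence $(x_j)_{j=1}^\infty$ in a Banach space $E$ is polynomially null if $P(x_j)\to 0$ for every scalar-valued continuous homogeneous polynomial $P$ on $E$. A Banach space $E$ is polynomially Schur if every polynomially null $E$-valued sequence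 is norm null. A sequence $(x_j)_{j=1}^\infty$ in a Banach lattice $E$ is regular-polynomially null if $P(x_j)\to 0$ for every scalar-valued regular homogeneous polynomial $P$ on $E$. A Banach lattice $E$ is positively polynomially Schur if every regular-polynomially null $E$-valued sequence of positive vectors is norm null. A Banach lattice has the positive Schur property if every weakly null sequence of positive vectors is norm null (equivalently, every disjoint weakly null sequence is norm null). A sequence $(x_j)_{j=1}^\infty$ in a Riesz space is disjoint if it is pairwise disjoint: $|x_i|\wedge|x_j|=0$ for $i\neq j$. *)

(* Defs.v *)
From HB Require Import structures.
From mathcomp Require Import all_boot all_order all_algebra all_fingroup.
From mathcomp Require Import all_classical all_reals all_analysis.
From mathcomp Require Import complex.

Set Implicit Arguments.
Unset Strict Implicit.
Unset Printing Implicit Defensive.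

Import Order.TTheory GRing.Theory Num.Theory.
Import numFieldNormedType.Exports.

Local Open Scope classical_set_scope.
Local Open Scope ring_scope.

(* Norms in MathComp-Analysis take their values in the scalar field K itself.
   The class below singles out what is needed of K for the sup norm of a bounded
   sequence to exist; its instances are the reals and the complex numbers. *)
HB.mixin Record NumField_hasSup K & Num.NumField K := {
  supremums_nneg : forall A : set K, A `<=` [set x | 0 <= x] ->
    A !=set0 -> ubound A !=set0 -> supremums A !=set0
}.

#[short(type="supFieldType")]
HB.structure Definition SupField := {K of Num.NumField K & NumField_hasSup K}.

Lemma real_supremums_nneg (R : realType) (A : set R) :
  A `<=` [set x | 0 <= x] -> A !=set0 -> ubound A !=set0 ->
  supremums A !=set0.
Proof.
move=> _ A0 Au; exists (sup A); split; first exact: sup_upper_bound.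
by move=> y; exact: ge_sup.
Qed.

HB.instance Definition _ (R : realType) :=
  NumField_hasSup.Build (Real.sort R) (@real_supremums_nneg R).

Lemma complex_supremums_nneg (R : realType) (A : set R[i]) :
  A `<=` [set x | 0 <= x] -> A !=set0 -> ubound A !=set0 ->
  supremums A !=set0.
Proof.
move=> Age [a Aa] [u Au].
pose B := (@complex.Re R) @` A.
have B0 : B !=set0 by exists (complex.Re a), a.
have Bub y : ubound A y -> ubound B (complex.Re y).
  by move=> Ay _ [x Ax <-]; have := Ay x Ax; rewrite lecE => /andP[].
have hB : has_sup B by split => //; exists (complex.Re u); exact: Bub.
exists (sup B)%:C%C; split => [x Ax|y Ay]; rewrite lecE.
- have /= := Age x Ax; rewrite lecE => /andP[/eqP -> _] /=.
  by rewrite eqxx /=; apply: sup_upper_bound => //; exists x.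
- have /= := Age a Aa; rewrite lecE => /andP[/= Ima _].
  have := Ay a Aa; rewrite lecE => /andP[/eqP -> _].
  by rewrite Ima /=; apply: ge_sup => //; exact: Bub.
Qed.

HB.instance Definition _ (R : realType) :=
  NumField_hasSup.Build R[i] (@complex_supremums_nneg R).

Section linfty.
Context {K : numFieldType}.
Variable E : normedModType K.

Definition bounded_seq : {pred nat -> E} := mem [set x | bounded_fun x].

Record linfty := Linfty {
  linfty_seq :> nat -> E;
  linftyP : linfty_seq \in bounded_seq }.

HB.instance Definition _ := [isSub for linfty_seq].
HB.instance Definition _ := [Choice of linfty by <:].

Lemma bounded_seqP (x : nat -> E) :
  reflect (exists M, forall n, `|x n| <= M) (x \in bounded_seq).
Proof.
have G := @globally_properfilter nat [set: nat] 0%N I.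
apply: (iffP idP) => [|[M xM]]; rewrite inE /=.
  by move=> /ex_bound[M xM]; exists M => n; exact: xM.
by apply/ex_bound; exists M => n _; exact: xM.
Qed.

Lemma bounded_seq_submod_closed : submod_closed bounded_seq.
Proof.
split.
  by apply/bounded_seqP; exists 0 => n; rewrite normr0.
move=> a x y /bounded_seqP[M xM] /bounded_seqP[N yN].
apply/bounded_seqP; exists (`|a| * M + N) => n.
by rewrite (le_trans (ler_normD _ _))// lerD// normrZ ler_wpM2l.
Qed.

HB.instance Definition _ :=
  GRing.isSubmodClosed.Build _ _ bounded_seq bounded_seq_submod_closed.
HB.instance Definition _ := [SubChoice_isSubLmodule of linfty by <:].

End linfty.
Arguments bounded_seq {K} E.

Section linfty_norm.
Variables (K : supFieldType) (E : normedModType K).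
Implicit Types x y : linfty E.

Definition linfty_norm x : K := supremum 0 (range (fun n => `|x n|)).

Lemma linfty_normP x : supremums (range (fun n => `|x n|)) (linfty_norm x).
Proof.
rewrite /linfty_norm /supremum; case: ifPn => [/eqP e0|_].
  have : range (fun n => `|x n|) `|x 0%N| by exists 0%N.
  by rewrite e0.
apply: xgetPex; apply: supremums_nneg.
- by move=> _ [n _ <-] /=.
- by exists `|x 0%N|, 0%N.
- by have /bounded_seqP[M xM] := linftyP x; exists M => _ [n _ <-].
Qed.

Lemma ler_linfty_norm x n : `|x n| <= linfty_norm x.
Proof. by have [+ _] := linfty_normP x; apply; exists n. Qed.

Lemma linfty_norm_le x M : (forall n, `|x n| <= M) -> linfty_norm x <= M.
Proof. by move=> xM; have [_] := linfty_normP x; apply=> _ [n _ <-]. Qed.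

Lemma linfty_norm_ge0 x : 0 <= linfty_norm x.
Proof. exact: le_trans (normr_ge0 (x 0%N)) (ler_linfty_norm x 0%N). Qed.

Lemma linfty_normD x y : linfty_norm (x + y) <= linfty_norm x + linfty_norm y.
Proof.
apply: linfty_norm_le => n.
by rewrite (le_trans (ler_normD _ _))// lerD// ler_linfty_norm.
Qed.

Lemma linfty_normZ (a : K) x : linfty_norm (a *: x) = `|a| * linfty_norm x.
Proof.
apply/le_anti/andP; split.
  apply: linfty_norm_le => n.
  by rewrite [X in `|X|](_ : _ = a *: x n)// normrZ ler_wpM2l// ler_linfty_norm.
have [->|a0] := eqVneq a 0; first by rewrite normr0 mul0r linfty_norm_ge0.
rewrite mulrC -ler_pdivlMr ?normr_gt0//; apply: linfty_norm_le => n.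
rewrite ler_pdivlMr ?normr_gt0// mulrC -normrZ.
exact: (ler_linfty_norm (a *: x)).
Qed.

Lemma linfty_norm0_eq0 x : linfty_norm x = 0 -> x = 0.
Proof.
move=> x0; apply/val_inj/funext => n /=.
by apply/eqP; rewrite -normr_le0 -x0 ler_linfty_norm.
Qed.

HB.instance Definition _ := Lmodule_isNormed.Build K (linfty E)
  linfty_normD linfty_normZ linfty_norm0_eq0.

End linfty_norm.

Section linfty_complete.
Variables (K : supFieldType) (E : completeNormedModType K).

Lemma linfty_complete (F : set_system (linfty E)) :
  ProperFilter F -> cauchy F -> cvg F.
Proof.
move=> FF /cauchy_ballP Fc.
have Fc' (e : K) : 0 < e ->
    \forall x & y \near F, forall n, `|(x : linfty E) n - (y : linfty E) n| < e.
  move=> e0; have := Fc e e0; apply: filterS => -[x y] /=.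
  rewrite -ball_normE /= => xy n; apply: le_lt_trans xy.
  exact: (ler_linfty_norm (x - y)).
have cvn n : cvg ((fun x : linfty E => x n) @ F).
  apply: cauchy_cvg; apply/cauchy_ballP => e e0.
  case: (Fc' e e0) => -[A B] /= [FA FB] AB.
  exists ((fun x : linfty E => x n) @` A, (fun x : linfty E => x n) @` B).
    by split; [apply: filterS FA|apply: filterS FB] => x ? /=; exists x.
  move=> [_ _] /= [[x Ax <-] [y By <-]].
  by rewrite -ball_normE /=; exact: (AB (x, y)).
pose l n := lim ((fun x : linfty E => x n) @ F).
have ln n (e : K) : 0 < e -> \forall x \near F, `|l n - (x : linfty E) n| < e.
  by move=> e0; have /cvgrPdist_lt := cvn n; exact.
have lx (e : K) : 0 < e ->
    \forall x \near F, forall n, `|l n - (x : linfty E) n| <= e.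
  move=> e0; have e20 : 0 < e / 2 by rewrite divr_gt0.
  have := Fc' _ e20 => /nearP_dep; apply: filterS => x xF n.
  have [y [xy ly]] := @filter_ex _ _ _ _ (filterI xF (ln n _ e20)).
  rewrite -[l n - _](subrKA (y n)) (splitr e).
  rewrite (le_trans (ler_normD _ _))// lerD ?(ltW ly)//.
  by rewrite distrC; exact/ltW/xy.
have lb : l \in bounded_seq E.
  have [x xl] := @filter_ex _ _ _ _ (lx 1 ltr01).
  have /bounded_seqP[M xM] := linftyP x.
  apply/bounded_seqP; exists (1 + M) => n.
  by rewrite -[l n](subrK (x n)) (le_trans (ler_normD _ _))// lerD.
apply/cvg_ex; exists (Linfty lb); apply/cvgrPdist_le => e e0.
have := lx e e0; apply: filterS => x xl.
exact: linfty_norm_le.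
Qed.

HB.instance Definition _ :=
  Uniform_isComplete.Build (linfty E) linfty_complete.

End linfty_complete.

Section sequences_and_polynomials.
Context {K : numFieldType}.
Variable E : normedModType K.
Implicit Types x : nat -> E.

Definition norm_null x := x n @[n --> \oo] --> (0 : E).

Definition weakly_null x := forall f : {linear E -> K^o},
  continuous (f : E -> K) -> f (x n) @[n --> \oo] --> (0 : K).

Definition multilinear n (A : ('I_n -> E) -> K) :=
  forall (i : 'I_n) (z : 'I_n -> E) (a : K) (u v : E),
    A [eta z with i |-> a *: u + v] =
    a * A [eta z with i |-> u] + A [eta z with i |-> v].

Definition symmetric_form n (A : ('I_n -> E) -> K) :=
  forall (s : 'S_n) (z : 'I_n -> E), A (z \o s) = A z.

(* Continuity of an n-homogeneous polynomial P is stated on P itself; it is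
   equivalent to continuity of the symmetric n-linear form of P. *)
Definition homogeneous_polynomial n (P : E -> K) :=
  exists2 A : ('I_n -> E) -> K, multilinear A & P = fun z => A (fun=> z).

Definition polynomially_null x := forall (n : nat) (P : E -> K),
  (0 < n)%N -> homogeneous_polynomial n P -> continuous P ->
  P (x j) @[j --> \oo] --> (0 : K).

Definition polynomially_schur :=
  forall x, polynomially_null x -> norm_null x.

End sequences_and_polynomials.

Section c0w.
Context {K : supFieldType}.
Variable E : normedModType K.

Definition c0w_pred : {pred linfty E} := mem [set x : linfty E | weakly_null x].

Record c0w := C0w { c0w_seq :> linfty E; c0wP : c0w_seq \in c0w_pred }.

HB.instance Definition _ := [isSub for c0w_seq].
HB.instance Definition _ := [Choice of c0w by <:].

Lemma c0w_submod_closed : submod_closed c0w_pred.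
Proof.
split.
  rewrite inE => f _ /=.
  rewrite (_ : (fun _ => _) = cst 0); first exact: cvg_cst.
  by apply/funext => n; rewrite linear0.
move=> a x y; rewrite !inE /= => x0 y0 f fc.
rewrite (_ : (fun _ => _) = (fun n => a * f (x n) + f (y n))).
  rewrite -[0](addr0 (0 : K)) -[X in X + _](mulr0 a).
  by apply: cvgD; [apply: cvgMl_tmp; exact: x0|exact: y0].
by apply/funext => n; rewrite linearP.
Qed.

HB.instance Definition _ :=
  GRing.isSubmodClosed.Build _ _ c0w_pred c0w_submod_closed.
HB.instance Definition _ := [SubChoice_isSubLmodule of c0w by <:].

Lemma c0w_normD (x y : c0w) :
  `|(x + y : c0w) : linfty E| <= `|x : linfty E| + `|y : linfty E|.
Proof. exact: ler_normD. Qed.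

Lemma c0w_normZ (a : K) (x : c0w) :
  `|(a *: x : c0w) : linfty E| = `|a| * `|x : linfty E|.
Proof. exact: normrZ. Qed.

Lemma c0w_norm0_eq0 (x : c0w) : `|x : linfty E| = 0 -> x = 0.
Proof. by move=> /normr0_eq0 x0; apply/val_inj. Qed.

HB.instance Definition _ := @Lmodule_isNormed.Build K c0w
  (fun x => `|x : linfty E|) c0w_normD c0w_normZ c0w_norm0_eq0.

End c0w.

(* The order is a field of its own: numDomainType already combines a partial
   order with a norm, and Hierarchy Builder does not accept a structure that
   combines the two over a module once numDomainType has been declared. *)
HB.mixin Record Lmodule_isRiesz (R : numDomainType) E & GRing.Lmodule R E := {
  lev : E -> E -> Prop;
  lev_refl : forall x, lev x x;
  lev_anti : forall x y, lev x y -> lev y x -> x = y;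
  lev_trans : forall y x z, lev x y -> lev y z -> lev x z;
  lev_add2r : forall z x y, lev x y -> lev (x + z) (y + z);
  lev_scale : forall (a : R) x y, 0 <= a -> lev x y -> lev (a *: x) (a *: y);
  vsup : E -> E -> E;
  vinf : E -> E -> E;
  vsup_le : forall x y z, lev (vsup x y) z <-> lev x z /\ lev y z;
  le_vinf : forall x y z, lev z (vinf x y) <-> lev z x /\ lev z y
}.

#[short(type="rieszType")]
HB.structure Definition Riesz (R : numDomainType) :=
  {E of GRing.Lmodule R E & Lmodule_isRiesz R E}.

Notation "x <=v y" := (lev x y) (at level 70, no associativity).

Definition modulus (R : numDomainType) (E : rieszType R) (x : E) : E :=
  vsup x (- x).

HB.mixin Record NormedRiesz_isBanachLattice (R : realType) E
    & CompleteNormedModule R E & Riesz R E := {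
  lev_norm : forall x y : E, modulus x <=v modulus y -> `|x| <= `|y|
}.

#[short(type="banachLatticeType")]
HB.structure Definition BanachLattice (R : realType) :=
  {E of CompleteNormedModule R E & Riesz R E
      & NormedRiesz_isBanachLattice R E}.

Section riesz_theory.
Variables (R : realType) (E : rieszType R).
Implicit Types x y z : E.

Lemma le_vsupl x y : x <=v vsup x y.
Proof. by have [] := (vsup_le x y _).1 (lev_refl _). Qed.

Lemma le_vsupr x y : y <=v vsup x y.
Proof. by have [] := (vsup_le x y _).1 (lev_refl _). Qed.

Lemma vinf_lel x y : vinf x y <=v x.
Proof. by have [] := (le_vinf x y _).1 (lev_refl _). Qed.

Lemma levD x y z t : x <=v y -> z <=v t -> x + z <=v y + t.
Proof.
move=> xy zt; apply: lev_trans (lev_add2r z _ _ xy) _.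
by rewrite ![y + _]addrC; exact: lev_add2r.
Qed.

Lemma lev_opp2 x y : x <=v y -> - y <=v - x.
Proof.
move=> /(lev_add2r (- x - y)).
by rewrite addrA subrr add0r addrCA subrr addr0.
Qed.

Lemma modulus_ge0 x : 0 <=v modulus x.
Proof.
have : 0 <=v modulus x + modulus x.
  by rewrite -(subrr x); apply: levD; [exact: le_vsupl|exact: le_vsupr].
have -> : modulus x + modulus x = 2%:R *: modulus x.
  by rewrite scaler_nat mulr2n.
move=> /(lev_scale (2%:R^-1 : R)).
rewrite scaler0 scalerA mulVf ?pnatr_eq0// scale1r; apply.
by rewrite invr_ge0 ler0n.
Qed.

Lemma ge0_modulus x : 0 <=v x -> modulus x = x.
Proof.
move=> x0; apply: lev_anti; last exact: le_vsupl.
apply/vsup_le; split; first exact: lev_refl.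
by apply: lev_trans (x0); rewrite -oppr0; exact: lev_opp2.
Qed.

Lemma modulus_id x : modulus (modulus x) = modulus x.
Proof. exact/ge0_modulus/modulus_ge0. Qed.

Lemma modulus_leD x y z :
  vinf x y <=v z -> z <=v vsup x y -> modulus z <=v modulus x + modulus y.
Proof.
have xD : modulus x <=v modulus x + modulus y.
  by rewrite -{1}[modulus x]addr0; apply: levD (lev_refl _) (modulus_ge0 _).
have yD : modulus y <=v modulus x + modulus y.
  by rewrite -{1}[modulus y]add0r; apply: levD (modulus_ge0 _) (lev_refl _).
move=> xyz zxy; apply/vsup_le; split.
  apply: lev_trans zxy _; apply/vsup_le; split.
    exact: lev_trans (le_vsupl _ _) xD.
  exact: lev_trans (le_vsupl _ _) yD.
rewrite -[modulus x + modulus y]opprK; apply/lev_opp2.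
apply: lev_trans xyz; apply/le_vinf.
split; rewrite -[X in _ <=v X]opprK; apply/lev_opp2.
  exact: lev_trans (le_vsupr _ _) xD.
exact: lev_trans (le_vsupr _ _) yD.
Qed.

End riesz_theory.

Section banach_lattice_theory.
Variables (R : realType) (E : banachLatticeType R).

Lemma norm_modulus (x : E) : `|modulus x| = `|x|.
Proof.
by apply/le_anti/andP; split; apply: lev_norm; rewrite modulus_id;
  exact: lev_refl.
Qed.

Lemma lev_norm_between (x y z : E) :
  vinf x y <=v z -> z <=v vsup x y -> `|z| <= `|x| + `|y|.
Proof.
move=> xyz zxy; rewrite -(norm_modulus x) -(norm_modulus y).
apply: le_trans (ler_normD _ _); apply: lev_norm.
rewrite [modulus (_ + _)]ge0_modulus; first exact: modulus_leD.
by rewrite -[0]addr0; apply: levD; exact: modulus_ge0.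
Qed.

End banach_lattice_theory.

Section linfty_lattice.
Variables (R : realType) (E : banachLatticeType R).
Implicit Types x y z : linfty E.

Definition linfty_le x y := forall n, x n <=v y n.

Lemma linfty_between x y (z : nat -> E) :
  (forall n, vinf (x n) (y n) <=v z n /\ z n <=v vsup (x n) (y n)) ->
  z \in bounded_seq E.
Proof.
move=> xyz; have /bounded_seqP[M xM] := linftyP x.
have /bounded_seqP[N yN] := linftyP y.
apply/bounded_seqP; exists (M + N) => n; have [? ?] := xyz n.
by apply: le_trans (lerD (xM n) (yN n)); exact: lev_norm_between.
Qed.

Lemma linfty_vinf_bounded x y : (fun n => vinf (x n) (y n)) \in bounded_seq E.
Proof.
apply: (@linfty_between x y) => n; split; first exact: lev_refl.
exact: lev_trans (vinf_lel _ _) (le_vsupl _ _).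
Qed.

Lemma linfty_vsup_bounded x y : (fun n => vsup (x n) (y n)) \in bounded_seq E.
Proof.
apply: (@linfty_between x y) => n; split; last exact: lev_refl.
exact: lev_trans (vinf_lel _ _) (le_vsupl _ _).
Qed.

Definition linfty_vinf x y := Linfty (linfty_vinf_bounded x y).
Definition linfty_vsup x y := Linfty (linfty_vsup_bounded x y).

Lemma linfty_le_refl x : linfty_le x x.
Proof. by move=> n; exact: lev_refl. Qed.

Lemma linfty_le_anti x y : linfty_le x y -> linfty_le y x -> x = y.
Proof.
move=> xy yx; apply/val_inj/funext => n.
exact: lev_anti (xy n) (yx n).
Qed.

Lemma linfty_le_trans y x z : linfty_le x y -> linfty_le y z -> linfty_le x z.
Proof. by move=> xy yz n; exact: lev_trans (xy n) (yz n). Qed.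

Lemma linfty_le_add2r z x y : linfty_le x y -> linfty_le (x + z) (y + z).
Proof. by move=> xy n; exact: lev_add2r (xy n). Qed.

Lemma linfty_le_scale (a : R) x y :
  0 <= a -> linfty_le x y -> linfty_le (a *: x) (a *: y).
Proof. by move=> a0 xy n; exact: lev_scale (xy n). Qed.

Lemma linfty_vsup_le x y z :
  linfty_le (linfty_vsup x y) z <-> linfty_le x z /\ linfty_le y z.
Proof.
split=> [h|[xz yz] n]; last by apply/vsup_le; split.
by split=> n; have /vsup_le[] := h n.
Qed.

Lemma linfty_le_vinf x y z :
  linfty_le z (linfty_vinf x y) <-> linfty_le z x /\ linfty_le z y.
Proof.
split=> [h|[xz yz] n]; last by apply/le_vinf; split.
by split=> n; have /le_vinf[] := h n.
Qed.

HB.instance Definition _ := Lmodule_isRiesz.Build R (linfty E)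
  linfty_le_refl linfty_le_anti linfty_le_trans linfty_le_add2r
  linfty_le_scale linfty_vsup_le linfty_le_vinf.

Lemma linfty_lev_norm x y : modulus x <=v modulus y -> `|x| <= `|y|.
Proof.
move=> xy; apply: linfty_norm_le => n.
exact: le_trans (lev_norm _ _ (xy n)) (ler_linfty_norm y n).
Qed.

HB.instance Definition _ := NormedRiesz_isBanachLattice.Build R (linfty E)
  linfty_lev_norm.

End linfty_lattice.

Definition infinite_dimensional (K : numFieldType) (X : lmodType K)
    (V : set X) :=
  ~ exists (n : nat) (b : 'I_n -> X), (forall i, V (b i)) /\
      forall v, V v -> exists c : 'I_n -> K, v = \sum_(i < n) c i *: b i.

Definition spaceable (K : numFieldType) (X : topologicalLmodType K)
    (A : set X) :=
  exists V : set X, [/\ submod_closed (mem V), closed V,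
    infinite_dimensional V & V `\ 0 `<=` A].

Definition sublattice (R : numDomainType) (X : rieszType R) (V : set X) :=
  submod_closed (mem V) /\
  forall x y, V x -> V y -> V (vsup x y) /\ V (vinf x y).

Definition completely_latticeable (R : realType)
    (X : banachLatticeType R) (A : set X) :=
  exists V : set X, [/\ sublattice V, closed V, infinite_dimensional V & V `\ 0 `<=` A].

Section banach_lattice_sequences.
Context {R : realType}.
Variable E : banachLatticeType R.
Implicit Types x : nat -> E.

Definition positive_seq x := forall j, 0 <=v x j.

Definition disjoint_seq x :=
  forall i j, i <> j -> vinf (modulus (x i)) (modulus (x j)) = 0.

Definition positive_schur :=
  forall x, positive_seq x -> weakly_null x -> norm_null x.

(* By polarization the symmetric form A is determined by P. *)
Definition positive_polynomial n (P : E -> R) :=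
  exists A : ('I_n -> E) -> R,
    [/\ multilinear A, symmetric_form A, P = (fun z => A (fun=> z)) &
        forall z, (forall i, 0 <=v z i) -> 0 <= A z].

Definition regular_polynomial n (P : E -> R) :=
  exists P1 P2 : E -> R, [/\ positive_polynomial n P1,
    positive_polynomial n P2 & P = P1 \- P2].

Definition regular_polynomially_null x := forall (n : nat) (P : E -> R),
  (0 < n)%N -> regular_polynomial n P -> P (x j) @[j --> \oo] --> (0 : R).

Definition positively_polynomially_schur :=
  forall x, positive_seq x -> regular_polynomially_null x -> norm_null x.

End banach_lattice_sequences.

(* Main.v *)
(* If x is a polynomially null sequence of unit vectors and nat is partitioned
   into infinitely many infinite fibres, the sequences n |-> a_i x_n (n in the
   i-th fibre, a bounded) form a closed infinite-dimensional space of
   polynomially null sequences, and none of them but 0 is norm null.  In a Banach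
   lattice the same space is a sublattice of disjoint sequences as soon as the
   x_n are positive and disjoint, so it remains to replace a positive sequence
   (x_n) of unit vectors that is null on positive functionals by a disjoint one.
   Either no order interval [0, w] almost contains a tail of (x_n); then the
   positive parts of x_(n_k) - B_k (x_(n_0) + ... + x_(n_(k-1))) - e_k X, for
   suitable constants and a vector X dominating all 2^-i x_(n_i), are disjoint
   and bounded below.  Or the problem reduces to 0 <= x_n <= w.  If every disjoint
   sequence in [0, w] were norm null, then monotone sequences in [0, w] would
   converge, and the suprema of the tails of a subsequence, tested against
   positive functionals norming the x_n, would give a contradiction.  Disjoint
   sequences in [0, w] are null on positive functionals, hence on positive
   polynomials. *)

Require Import Defs.
From HB Require Import structures.
From mathcomp Require Import all_boot all_order all_algebra.
From mathcomp Require Import all_classical all_reals all_analysis.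
From mathcomp Require Import complex.
From mathcomp Require Import ring lra.

Set Implicit Arguments.
Unset Strict Implicit.
Unset Printing Implicit Defensive.

Import Order.TTheory GRing.Theory Num.Theory.
Import numFieldNormedType.Exports.

Local Open Scope classical_set_scope.
Local Open Scope ring_scope.

(** * Riesz spaces *)

Section riesz_space.
Context {R : realType} {E : rieszType R}.
Implicit Types (x y z a b c d : E).

Lemma lev_subr_ge0 x y : 0 <=v y - x <-> x <=v y.
Proof.
split=> [/(lev_add2r x)|/(lev_add2r (- x))]; first by rewrite add0r subrK.
by rewrite subrr.
Qed.

Lemma addv_ge0 x y : 0 <=v x -> 0 <=v y -> 0 <=v x + y.
Proof. by move=> x0 y0; rewrite -[0]addr0; exact: levD. Qed.

Lemma scalev_ge0 (t : R) x : 0 <= t -> 0 <=v x -> 0 <=v t *: x.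
Proof. by move=> t0 x0; rewrite -[0](scaler0 _ t); exact: lev_scale. Qed.

Lemma lev_scale2 (s t : R) x : s <= t -> 0 <=v x -> s *: x <=v t *: x.
Proof.
move=> st x0; apply/lev_subr_ge0; rewrite -scalerBl.
by apply: scalev_ge0 => //; rewrite subr_ge0.
Qed.

Lemma lev_sum (I : Type) (r : seq I) (F G : I -> E) :
  (forall i, F i <=v G i) -> \sum_(i <- r) F i <=v \sum_(i <- r) G i.
Proof.
by move=> FG; elim/big_ind2: _ => //; [exact: lev_refl|move=> *; exact: levD].
Qed.

Lemma sumv_ge0 (I : Type) (r : seq I) (P : pred I) (F : I -> E) :
  (forall i, 0 <=v F i) -> 0 <=v \sum_(i <- r | P i) F i.
Proof.
by move=> F0; elim/big_ind: _ => //; [exact: lev_refl|move=> *; exact: addv_ge0].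
Qed.

Lemma vinf_ler x y : vinf x y <=v y.
Proof. by have [] := (le_vinf x y _).1 (lev_refl _). Qed.

Lemma vinf_mono x y a b : x <=v a -> y <=v b -> vinf x y <=v vinf a b.
Proof.
move=> xa yb; apply/le_vinf; split.
  exact: lev_trans (vinf_lel _ _) xa.
exact: lev_trans (vinf_ler _ _) yb.
Qed.

Lemma vsup_mono x y a b : x <=v a -> y <=v b -> vsup x y <=v vsup a b.
Proof.
move=> xa yb; apply/vsup_le; split.
  exact: lev_trans xa (le_vsupl _ _).
exact: lev_trans yb (le_vsupr _ _).
Qed.

Lemma vinfC x y : vinf x y = vinf y x.
Proof.
by apply: lev_anti; apply/le_vinf; split; (exact: vinf_lel || exact: vinf_ler).
Qed.

Lemma vsupC x y : vsup x y = vsup y x.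
Proof.
by apply: lev_anti; apply/vsup_le; split; (exact: le_vsupl || exact: le_vsupr).
Qed.

Lemma vinf_idPl x y : x <=v y -> vinf x y = x.
Proof.
move=> xy; apply: lev_anti; first exact: vinf_lel.
by apply/le_vinf; split => //; exact: lev_refl.
Qed.

Lemma vsup_idPr x y : x <=v y -> vsup x y = y.
Proof.
move=> xy; apply: lev_anti; last exact: le_vsupr.
by apply/vsup_le; split => //; exact: lev_refl.
Qed.

Lemma vsup_idPl x y : y <=v x -> vsup x y = x.
Proof.
move=> xy; apply: lev_anti; last exact: le_vsupl.
by apply/vsup_le; split => //; exact: lev_refl.
Qed.

Lemma vsupDr z x y : vsup (x + z) (y + z) = vsup x y + z.
Proof.
apply: lev_anti.
  by apply/vsup_le; split; apply: lev_add2r; [exact: le_vsupl|exact: le_vsupr].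
rewrite -[X in _ <=v X](subrK z); apply: lev_add2r.
by apply/vsup_le; split; rewrite -[X in X <=v _](addrK z); apply: lev_add2r;
  [exact: le_vsupl|exact: le_vsupr].
Qed.

(** Reflection in [c] reverses the order, so it exchanges suprema and infima. *)
Lemma vinf_subl c x y : vinf (c - x) (c - y) = c - vsup x y.
Proof.
apply: lev_anti.
  rewrite -[X in X <=v _](subKr c) -[X in _ <=v X]addrC -[X in _ <=v X]addrC.
  apply: levD (lev_refl _) _; apply: lev_opp2; apply/vsup_le; split.
    by rewrite -[X in X <=v _](subKr c); apply: levD (lev_refl _) _;
      apply: lev_opp2; exact: vinf_lel.
  by rewrite -[X in X <=v _](subKr c); apply: levD (lev_refl _) _;
    apply: lev_opp2; exact: vinf_ler.
by apply/le_vinf; split; apply: levD (lev_refl _) _; apply: lev_opp2;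
  [exact: le_vsupl|exact: le_vsupr].
Qed.

Lemma vsup_add_vinf x y : vsup x y + vinf x y = x + y.
Proof.
have -> : vinf x y = x + y - vsup x y.
  by rewrite -vinf_subl addrK addrAC subrr add0r vinfC.
by rewrite addrC subrK.
Qed.

Lemma vinf_scale (t : R) x y :
  0 <= t -> vinf (t *: x) (t *: y) = t *: vinf x y.
Proof.
move=> t0; have [->|tn0] := eqVneq t 0.
  by rewrite !scale0r; apply: vinf_idPl; exact: lev_refl.
have ti : 0 <= t^-1 by rewrite invr_ge0.
apply: lev_anti; last first.
  by apply/le_vinf; split; apply: lev_scale => //;
    [exact: vinf_lel|exact: vinf_ler].
rewrite -[X in X <=v _]scale1r -(divff tn0) -scalerA.
apply: lev_scale => //; apply/le_vinf; split.
  rewrite -[X in _ <=v X]scale1r -(mulVf tn0) -scalerA.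
  by apply: lev_scale => //; exact: vinf_lel.
rewrite -[X in _ <=v X]scale1r -(mulVf tn0) -scalerA.
by apply: lev_scale => //; exact: vinf_ler.
Qed.

Lemma vsup_scale_ge0 (s t : R) x :
  0 <=v x -> vsup (s *: x) (t *: x) = Num.max s t *: x.
Proof.
move=> x0; have [st|/ltW ts] := leP s t.
  by apply: vsup_idPr; exact: lev_scale2.
by apply: vsup_idPl; exact: lev_scale2.
Qed.

Lemma vinf_scale_ge0 (s t : R) x :
  0 <=v x -> vinf (s *: x) (t *: x) = Num.min s t *: x.
Proof.
move=> x0; have [st|/ltW ts] := leP s t.
  by apply: vinf_idPl; exact: lev_scale2.
by rewrite vinfC; apply: vinf_idPl; exact: lev_scale2.
Qed.

Lemma modulus_scale_ge0 (t : R) x : 0 <=v x -> modulus (t *: x) = `|t| *: x.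
Proof. by move=> x0; rewrite /modulus -scaleNr vsup_scale_ge0// maxrN. Qed.

Definition vpos x := vsup x 0.

Lemma vpos_ge0 x : 0 <=v vpos x.
Proof. exact: le_vsupr. Qed.

Lemma le_vpos x : x <=v vpos x.
Proof. exact: le_vsupl. Qed.

Lemma vpos_le x y : 0 <=v y -> x <=v y -> vpos x <=v y.
Proof. by move=> y0 xy; apply/vsup_le. Qed.

Lemma vpos_mono x y : x <=v y -> vpos x <=v vpos y.
Proof. by move=> xy; apply: vsup_mono => //; exact: lev_refl. Qed.

Lemma vpos_subE x y : vpos (x - y) = vsup x y - y.
Proof. by rewrite /vpos -[X in vsup _ X](subrr y) vsupDr. Qed.

Lemma vposB_vinf x y : vpos (x - y) = x - vinf x y.
Proof.
rewrite vpos_subE; apply/eqP.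
by rewrite subr_eq addrAC eq_sym subr_eq vsup_add_vinf.
Qed.

Lemma vpos_scale (t : R) x : 0 <= t -> vpos (t *: x) = t *: vpos x.
Proof.
move=> t0; rewrite -[t *: x]subr0 -[in RHS](subr0 x) !vposB_vinf.
by rewrite scalerBr -vinf_scale// scaler0.
Qed.

Lemma vpos_subadd x y : vpos (x + y) <=v vpos x + vpos y.
Proof.
apply: vpos_le; first by apply: addv_ge0; exact: vpos_ge0.
by apply: levD; exact: le_vpos.
Qed.

Lemma vpos_disjoint x y : vinf (vpos (x - y)) (vpos (y - x)) = 0.
Proof. by rewrite !vpos_subE (vsupC y x) vinf_subl (vsupC y x) subrr. Qed.

Lemma disjoint_le x y a b : 0 <=v a -> 0 <=v b -> a <=v x -> b <=v y ->
  vinf x y = 0 -> vinf a b = 0.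
Proof.
move=> a0 b0 ax bY xy; apply: lev_anti; last by apply/le_vinf.
by rewrite -xy; exact: vinf_mono.
Qed.

Lemma disjoint_scale (s t : R) x y : 0 <= s -> 0 <= t -> 0 <=v x -> 0 <=v y ->
  vinf x y = 0 -> vinf (s *: x) (t *: y) = 0.
Proof.
move=> s0 t0 x0 y0 xy.
apply: (@disjoint_le (Num.max s t *: x) (Num.max s t *: y));
  do ?exact: scalev_ge0.
- by apply: lev_scale2 => //; rewrite le_max lexx.
- by apply: lev_scale2 => //; rewrite le_max lexx orbT.
- by rewrite vinf_scale ?xy ?scaler0// le_max s0.
Qed.

(** The difference [m - vinf c a] is the supremum of [m - c <= 0] and [m - a], and [m - a] lies
    below both [c] and [b]. *)
Lemma vinfD_le c a b : 0 <=v c -> 0 <=v a -> 0 <=v b ->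
  vinf c (a + b) <=v vinf c a + vinf c b.
Proof.
move=> c0 a0 b0; set m := vinf c (a + b).
apply/lev_subr_ge0; rewrite addrC addrA.
have -> : - m + vinf c a = - vsup (m - c) (m - a).
  by have := vinf_subl m (m - c) (m - a); rewrite !subKr => ->; rewrite addKr.
rewrite addrC; apply/lev_subr_ge0; apply/vsup_le; split.
  apply: (@lev_trans _ _ 0); last by apply/le_vinf.
  by rewrite -(subrr c); apply: lev_add2r; exact: vinf_lel.
apply/le_vinf; split.
  apply: lev_trans (vinf_lel c (a + b)); rewrite -[X in _ <=v X]addr0.
  by apply: levD (lev_refl _) _; rewrite -oppr0; exact: lev_opp2.
have /(lev_add2r (- a)) := vinf_ler c (a + b).
by rewrite addrAC subrr add0r.
Qed.

Lemma vinf_sum_le (I : Type) (r : seq I) c (F : I -> E) : 0 <=v c ->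
  (forall i, 0 <=v F i) ->
  vinf c (\sum_(i <- r) F i) <=v \sum_(i <- r) vinf c (F i).
Proof.
move=> c0 F0; elim: r => [|i r ih]; first by rewrite !big_nil; exact: vinf_ler.
rewrite !big_cons; apply: lev_trans (vinfD_le c0 (F0 i) (sumv_ge0 _ _ F0)) _.
exact: levD (lev_refl _) ih.
Qed.

(** The meet [m] is disjoint from the negative parts of [a] and [b], while [m <= m + m] lies below
    [vpos (a + b)] plus these negative parts. Meeting that bound with [m] leaves only
    [vpos (a + b)]. *)
Lemma vinf_vpos_le a b : vinf (vpos a) (vpos b) <=v vpos (a + b).
Proof.
set m := vinf _ _.
have m0 : 0 <=v m by apply/le_vinf; split; exact: vpos_ge0.
have disj z : m <=v vpos z -> vinf m (vpos (- z)) = 0.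
  move=> mz; apply: (disjoint_le m0 (vpos_ge0 _) mz (lev_refl _)).
  by have := vpos_disjoint z 0; rewrite subr0 sub0r.
have mE : m <=v vpos (a + b) + (vpos (- a) + vpos (- b)).
  have dec z : vpos z = z + vpos (- z).
    by rewrite -[- z]sub0r vpos_subE addrC subrK vsupC.
  apply: (@lev_trans _ _ (m + m)).
    by rewrite -{1}[m]addr0; exact: levD (lev_refl _) m0.
  apply: (@lev_trans _ _ (vpos a + vpos b)).
    by apply: levD; [exact: vinf_lel|exact: vinf_ler].
  rewrite (dec a) (dec b) addrACA; apply: levD (lev_refl _).
  exact: le_vpos.
rewrite -(vinf_idPl mE).
apply: lev_trans (vinfD_le m0 (vpos_ge0 _) _) _.
  by apply: addv_ge0; exact: vpos_ge0.
rewrite -[X in _ <=v X]addr0; apply: levD; first exact: vinf_ler.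
apply: lev_trans (vinfD_le m0 (vpos_ge0 _) (vpos_ge0 _)) _.
rewrite (disj a) ?(disj b) ?addr0; first exact: lev_refl.
  exact: vinf_ler.
exact: vinf_lel.
Qed.

(* Where y - x > 2d, some multiple jd lies between x and y at distance comparable
   to y - x from both; the hat functions t_j - t_(j+1) of x on the grid sum to d
   and localize the estimate. *)
Lemma grid_estimate (N : nat) d x y : 0 <=v d -> 0 <=v x -> x <=v y ->
  y <=v N%:R *: d ->
  y - x <=v 2 *: d + N%:R *: \sum_(j < N.+1)
    vinf (vpos (y - j.+1%:R *: d)) (vpos (j.+1%:R *: d - x)).
Proof.
move=> d0 x0 xy yN; set S := \sum_(j < _) _.
pose v := vpos (y - x - 2 *: d).
have v0 : 0 <=v v := vpos_ge0 _.
suff vS : v <=v N%:R *: S.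
  apply: (@lev_trans _ _ (2 *: d + v)).
    by rewrite -[X in X <=v _](subrK (2 *: d)) addrC;
      exact: levD (lev_refl _) (le_vpos _).
  exact: levD (lev_refl _) vS.
have vN : v <=v N%:R *: d.
  apply: vpos_le; first exact: scalev_ge0.
  apply: lev_trans yN; rewrite -addrA -[X in _ <=v X]addr0.
  apply: levD (lev_refl _) _; rewrite -oppr0 -opprD; apply: lev_opp2.
  by apply: addv_ge0 => //; exact: scalev_ge0.
(* Since [v] lies below a sum of [N] copies of [d], it is at most [N] times [vinf v d]; it remains
   to bound [vinf v d] by [S]. *)
rewrite -(vinf_idPl vN).
have -> : N%:R *: d = \sum_(i < N) d by rewrite sumr_const card_ord scaler_nat.
apply: lev_trans (vinf_sum_le _ v0 (fun=> d0)) _.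
rewrite sumr_const card_ord -scaler_nat; apply: lev_scale => //.
pose t j := vinf (vpos (x - j%:R *: d + d)) d.
have tS j : t j.+1 = vinf (vpos (x - j%:R *: d)) d.
  by rewrite /t mulrS scalerDl scale1r opprD addrA addrAC subrK.
have t_dec j : t j.+1 <=v t j.
  rewrite tS; apply: vinf_mono (lev_refl _); apply: vpos_mono.
  by rewrite -[X in X <=v _]addr0; exact: levD (lev_refl _) d0.
have t0 : t 0%N = d.
  rewrite /t scale0r subr0 vinfC; apply: vinf_idPl; apply: lev_trans (le_vpos _).
  by rewrite -[X in X <=v _]add0r; exact: levD x0 (lev_refl _).
have tN : t N.+1 = 0.
  rewrite tS; apply: lev_anti; last by apply/le_vinf; split => //; exact: vpos_ge0.
  apply: lev_trans (vinf_lel _ _) _; apply: vpos_le; first exact: lev_refl.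
  rewrite -(subrr (N%:R *: d)); apply: lev_add2r; exact: lev_trans xy yN.
have -> : d = \sum_(j < N.+1) (t j - t j.+1).
  rewrite -(big_mkord xpredT (fun j => t j - t j.+1)).
  rewrite (telescope_sumr_eq (fun j => - t j))// => [|k _].
    by rewrite tN t0 oppr0 opprK add0r.
  by rewrite opprK addrC.
apply: lev_trans (vinf_sum_le _ v0 _) _; first by move=> j; apply/lev_subr_ge0.
apply: lev_sum => j; set q := t j - t j.+1.
have q1 : q <=v vpos (x - j%:R *: d + d).
  apply: (@lev_trans _ _ (t j)); last exact: vinf_lel.
  apply/lev_subr_ge0; rewrite subKr tS; apply/le_vinf; split => //.
  exact: vpos_ge0.
have q2 : q <=v vpos (j.+1%:R *: d - x).
  apply: (@lev_trans _ _ (d - t j.+1)).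
    by apply: lev_add2r; exact: vinf_ler.
  rewrite tS vinfC -vposB_vinf; apply: vpos_mono.
  rewrite mulrS scalerDl scale1r -addrA; apply: levD (lev_refl _) _.
  by rewrite -[X in _ <=v X]opprB; apply: lev_opp2; exact: le_vpos.
apply/le_vinf; split; last exact: lev_trans (vinf_ler _ _) q2.
(* The positive parts have arguments [y - x - 2 d] and [x - j d + d], whose sum is
   [y - (j + 1) d]. *)
apply: lev_trans (vinf_mono (lev_refl _) q1) _.
apply: lev_trans (vinf_vpos_le _ _) _.
rewrite (_ : _ + _ = y - j.+1%:R *: d); first exact: lev_refl.
have -> : 2 *: d = d + d by rewrite scaler_nat mulr2n.
rewrite mulrS scalerDl scale1r; move: (j%:R *: d) => e.
rewrite (addrC (x - e)) (addrA _ d) (opprD d d) (addrA _ (- d)) subrK.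
by rewrite (opprD d e) -!addrA; congr (y + _); rewrite addrCA addKr.
Qed.

End riesz_space.

(** * A sandwich theorem *)

Section sandwich.
Context {R : realType} {E : lmodType R}.
Variable p : E -> R.
Hypothesis p_subadd : forall x y, p (x + y) <= p x + p y.
Hypothesis p_scale : forall t x, 0 <= t -> p (t *: x) = t * p x.

(** A pair [(x, r)] encodes the requirement [r <= f x] on the functional sought. *)
Let cone (A : set (E * R)) :=
  (forall u v, A u -> A v -> A (u.1 + v.1, u.2 + v.2)) /\
  (forall t u, 0 <= t -> A u -> A (t *: u.1, t * u.2)).

Let dominated (A : set (E * R)) := forall u, A u -> u.2 <= p u.1.

(* A maximal cone below [p] is the hypograph of a linear functional. *)
Theorem sandwich (C : set (E * R)) : cone C -> dominated C -> C !=set0 ->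
  exists f : {linear E -> R^o},
    (forall x, f x <= p x) /\ (forall u, C u -> u.2 <= f u.1).
Proof.
move=> Ccone Cdom [c0 Cc0].
(* The last clause replaces the inclusion of [C] in [A], because the empty set, as the union of the
   empty chain, must satisfy [P]. A maximal [A] is nonempty since [C] itself satisfies [P]. *)
pose P (A : set (E * R)) := [/\ cone A, dominated A &
  forall u v, A u -> C v -> A (u.1 + v.1, u.2 + v.2)].
have PC : P C by split => //; exact: Ccone.1.
have [A [[Acone Adom AC] Amax]] : exists A, P A /\ forall B, A `<` B -> ~ P B.
  apply: Zorn_bigcup => F FP Ftot.
  split; first split.
  - move=> u v [X FX Xu] [Y FY Yv]; have [XY|YX] := Ftot _ _ FX FY.
      by exists Y => //; have [[+ _] _ _] := FP _ FY; apply => //; exact: XY.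
    by exists X => //; have [[+ _] _ _] := FP _ FX; apply => //; exact: YX.
  - move=> t u t0 [X FX Xu]; exists X => //.
    by have [[_ +] _ _] := FP _ FX; exact.
  - by move=> u [X FX Xu]; have [_ + _] := FP _ FX; exact.
  - move=> u v [X FX Xu] Cv; exists X => //.
    by have [_ _ +] := FP _ FX; exact.
have A0 : A (0, 0).
  suff [a Aa] : A !=set0.
    by have := Acone.2 _ _ (lexx 0) Aa; rewrite scale0r mul0r.
  apply/set0P/negP => /eqP A0; apply: (Amax C) => //; rewrite A0.
  by split => // /(_ _ Cc0).
have CA : C `<=` A.
  by move=> v /(AC _ _ A0); rewrite /= !add0r; case: v.
have p0 : p 0 = 0 by rewrite -(scale0r 0) p_scale// mul0r.
pose S x := [set p (x + v.1) - v.2 | v in A].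
(* The largest [r] for which adjoining [(x, r)] to [A] keeps the cone below [p]. *)
pose q x := inf (S x).
have S_lb x : lbound (S x) (- p (- x)).
  move=> _ [v Av <-]; rewrite lerBrDr addrC lerBlDr.
  apply: le_trans (Adom _ Av) _; apply: le_trans (p_subadd _ _).
  by rewrite addrC addrA addNr add0r.
have q_le x v : A v -> q x <= p (x + v.1) - v.2.
  move=> Av; apply: ge_inf; last by exists v.
  by exists (- p (- x)); exact: S_lb.
have le_q x r : (forall v, A v -> r <= p (x + v.1) - v.2) -> r <= q x.
  move=> h; apply: lb_le_inf; first by exists (p (x + 0) - 0), (0, 0).
  by move=> _ [v Av <-]; exact: h.
have A_le_q x r : A (x, r) -> r <= q x.
  move=> Ax; apply: le_q => v Av; rewrite lerBrDr.
  exact: (Adom _ (Acone.1 _ _ Ax Av)).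
have Aq x : A (x, q x).
  (* The cone generated by [A] and [(x, q x)] again satisfies [P], so by maximality it is not
     strictly larger than [A]. *)
  pose B := [set w | exists v t,
    [/\ A v, 0 <= t & w = (v.1 + t *: x, v.2 + t * q x)]].
  apply: contrapT => nAq; apply: (Amax B).
    split => [v Av|BA].
      by exists v, 0; rewrite scale0r mul0r !addr0; split => //; case: v Av.
    apply/nAq/BA; exists (0, 0), 1; split => //=.
    by rewrite scale1r mul1r !add0r.
  split; first split.
  - move=> _ _ [v [s [Av s0 ->]]] [w [t [Aw t0 ->]]] /=.
    exists (v.1 + w.1, v.2 + w.2), (s + t); split => /=.
    + exact: Acone.1.
    + exact: addr_ge0.
    + by rewrite scalerDl mulrDl; congr pair; rewrite addrACA.
  - move=> s _ s0 [v [t [Av t0 ->]]] /=.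
    exists (s *: v.1, s * v.2), (s * t); split => /=.
    + exact: Acone.2.
    + exact: mulr_ge0.
    + by rewrite scalerDr scalerA mulrDr mulrA.
  - move=> _ [v [t [Av + ->]]] /=; rewrite le_eqVlt => /predU1P[<-|t0].
      by rewrite scale0r mul0r !addr0; exact: Adom.
    have ti : 0 <= t^-1 by rewrite invr_ge0 ltW.
    have := q_le x _ (Acone.2 _ _ ti Av).
    rewrite -(ler_pM2l t0) mulrBr /= mulrA divff ?gt_eqF// mul1r.
    rewrite -(p_scale _ (ltW t0)) scalerDr scalerA divff ?gt_eqF// scale1r.
    by rewrite lerBrDr addrC (addrC v.1).
  - move=> _ w [v [t [Av t0 ->]]] Cw /=.
    exists (v.1 + w.1, v.2 + w.2), t; split => //=; first exact: AC.
    by rewrite addrAC [X in (_, X)]addrAC.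
have q0 : q 0 = 0.
  apply/le_anti/andP; split; last exact: A_le_q.
  by have := q_le 0 _ A0; rewrite /= addr0 subr0 p0.
have qD_ge x y : q x + q y <= q (x + y).
  by apply: A_le_q; exact: (Acone.1 _ _ (Aq x) (Aq y)).
have qN x : q (- x) = - q x.
  apply/le_anti/andP; split.
    by have := qD_ge (- x) x; rewrite addNr q0 addrC -lerBrDl sub0r.
  (* For [v] and [w] in [A], [v.2 + w.2 <= p (v.1 + w.1) <= p (- x + v.1) + p (x + w.1)]; then take
     both infima. *)
  rewrite lerNl -[leRHS]opprK lerN2; apply: (le_q) => v Av; rewrite lerNl.
  apply: le_q => w Aw; have := Adom _ (Acone.1 _ _ Av Aw) => /=.
  have := p_subadd (- x + v.1) (x + w.1).
  by rewrite addrACA addNr add0r => ? ?; lra.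
have qD x y : q (x + y) = q x + q y.
  apply/le_anti; rewrite qD_ge andbT.
  have := qD_ge (x + y) (- y); rewrite addrK qN.
  by rewrite lerBlDr.
have qZ_ge t x : 0 <= t -> t * q x <= q (t *: x).
  by move=> t0; apply: A_le_q; exact: (Acone.2 _ _ t0 (Aq x)).
have qZ_pos t x : 0 <= t -> q (t *: x) = t * q x.
  move=> t0; apply/le_anti; rewrite qZ_ge// andbT.
  by have := qZ_ge t (- x) t0; rewrite scalerN !qN mulrN lerN2.
have q_lin : scalable (q : E -> R^o).
  move=> t x; have [t0|t0] := leP 0 t; first exact: qZ_pos.
  have := @qZ_pos (- t) x; rewrite oppr_ge0 ltW// => /(_ isT).
  by rewrite scaleNr qN mulNr => /oppr_inj.
have q_lin' : linear (q : E -> R^o) by move=> t x y; rewrite qD q_lin.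
pose qL := GRing.isLinear.Build R E R^o *:%R q q_lin'.
pose f : {linear E -> R^o} := HB.pack q qL.
exists f; split => [x|[v r] Cv] /=; last by apply: A_le_q; exact: CA.
by have := q_le x _ A0; rewrite /= addr0 subr0.
Qed.
End sandwich.

(** * Positive functionals on a Banach lattice *)

Section banach_lattice_functionals.
Context {R : realType} {E : banachLatticeType R}.
Implicit Types (x y : E) (f g : {linear E -> R^o}).

Lemma lev_norm_ge0 x y : 0 <=v x -> x <=v y -> `|x| <= `|y|.
Proof.
move=> x0 xy; apply: lev_norm; rewrite ge0_modulus//.
exact: lev_trans xy (le_vsupl _ _).
Qed.

Lemma norm_vpos x : `|vpos x| <= `|x|.
Proof.
rewrite -(norm_modulus x); apply: lev_norm_ge0; first exact: vpos_ge0.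
by apply: vpos_le; [exact: modulus_ge0|exact: le_vsupl].
Qed.

Lemma norm_sub_le_add x y : 0 <=v x -> 0 <=v y -> `|x - y| <= `|x + y|.
Proof.
move=> x0 y0; apply: lev_norm; rewrite (ge0_modulus (addv_ge0 x0 y0)).
have le_sub (a b : E) : 0 <=v b -> a - b <=v a + b.
  move=> b0; apply: levD (lev_refl a) _; apply: (@lev_trans _ _ 0) => //.
  by rewrite -oppr0; exact: lev_opp2.
apply/vsup_le; split; first exact: le_sub.
by rewrite opprB (addrC x); exact: le_sub.
Qed.

Definition positive_functional f := forall x, 0 <=v x -> 0 <= f x.

Lemma positive_functional_le f x y :
  positive_functional f -> x <=v y -> f x <= f y.
Proof.
by move=> f0 /lev_subr_ge0 /f0; rewrite linearB/= subr_ge0.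
Qed.

(** Adding positive vectors to the first components of [C] keeps it below [M] times the norm, which
    is monotone on positive vectors. The sandwich theorem applies to this larger cone, and its
    elements [(z, 0)] with [z] positive make [f] positive. *)
Lemma positive_extension (M : R) (C : set (E * R)) : 0 <= M -> C !=set0 ->
  (forall u v, C u -> C v -> C (u.1 + v.1, u.2 + v.2)) ->
  (forall t u, 0 <= t -> C u -> C (t *: u.1, t * u.2)) ->
  (forall u, C u -> 0 <=v u.1 /\ u.2 <= M * `|u.1|) ->
  exists f, [/\ positive_functional f, forall x, `|f x| <= M * `|x| &
    forall u, C u -> u.2 <= f u.1].
Proof.
move=> M0 [c0 Cc0] CD CZ CM.
pose D := [set w : E * R | exists u z,
  [/\ C u, 0 <=v z & w = (u.1 + z, u.2)]].
have CsubD : C `<=` D.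
  move=> u Cu; exists u, 0; rewrite addr0.
  by split => //; [exact: lev_refl|case: u Cu].
have [|||||f [fM Df]] := @sandwich _ _ (fun x => M * `|x|) _ _ D.
- by move=> x y; rewrite -mulrDr ler_wpM2l// ler_normD.
- by move=> t x t0; rewrite normrZ ger0_norm// mulrCA.
- split.
    move=> _ _ [u [y [Cu y0 ->]]] [v [z [Cv z0 ->]]] /=.
    exists (u.1 + v.1, u.2 + v.2), (y + z); split => /=.
    + exact: CD.
    + exact: addv_ge0.
    + by rewrite addrACA.
  move=> t _ t0 [u [y [Cu y0 ->]]] /=.
  exists (t *: u.1, t * u.2), (t *: y); split => /=.
  + exact: CZ.
  + exact: scalev_ge0.
  + by rewrite scalerDr.
- move=> _ [u [y [Cu y0 ->]]] /=; have [u0 /le_trans] := CM _ Cu; apply.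
  apply: ler_wpM2l => //; apply: lev_norm_ge0 => //.
  by rewrite -[X in X <=v _]addr0; exact: levD (lev_refl _) y0.
- by exists c0; exact: CsubD.
exists f; split => [x x0|x|u /CsubD]; last exact: Df.
- apply: (Df (x, 0)); exists (0, 0), x; split => //; last by rewrite add0r.
  by have := CZ _ _ (lexx 0) Cc0; rewrite scale0r mul0r.
- by rewrite ler_norml fM andbT lerNl -linearN -normrN fM.
Qed.

(** Extension from the ray through [x], with value the norm of [x]. *)
Lemma norming_positive_functional x : 0 <=v x ->
  exists f, [/\ positive_functional f, forall y, `|f y| <= `|y| & f x = `|x|].
Proof.
move=> x0.
pose C := [set u : E * R | exists2 t : R, 0 <= t & u = (t *: x, t * `|x|)].
have Cx : C (x, `|x|) by exists 1; rewrite ?scale1r ?mul1r.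
have [|||||f [f0 f1 fC]] := @positive_extension 1 C => //.
- by exists (x, `|x|).
- move=> _ _ [s s0 ->] [t t0 ->] /=; exists (s + t); first exact: addr_ge0.
  by rewrite scalerDl mulrDl.
- move=> s _ s0 [t t0 ->] /=; exists (s * t); first exact: mulr_ge0.
  by rewrite scalerA mulrA.
- move=> _ [t t0 ->] /=; split; first exact: scalev_ge0.
  by rewrite normrZ ger0_norm// mul1r.
exists f; split => // [y|]; first by rewrite -[leRHS]mul1r.
apply/le_anti; rewrite (fC _ Cx) andbT.
by have := f1 x; rewrite mul1r; apply: le_trans; exact: ler_norm.
Qed.

Lemma linear_bound_continuous (M : R) f :
  (forall x, `|f x| <= M * `|x|) -> continuous (f : E -> R).
Proof.
move=> fM; apply: (@bounded_linear_continuous _ E R^o f).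
apply/linear_boundedP; exists M; split; first exact: num_real.
by move=> r /ltW Mr x; apply: le_trans (fM x) _; rewrite ler_wpM2r.
Qed.

(** A substitute for the modulus of [f] in the dual lattice. The pairs [(y + z, f y - f z)] are
    admissible because [y - z] has norm at most that of [y + z]; taking [z = 0] or [y = 0] gives the
    two bounds on [f]. *)
Lemma dominating_positive_functional f : continuous (f : E -> R) ->
  exists g, [/\ positive_functional g, continuous (g : E -> R) &
    forall x, 0 <=v x -> `|f x| <= g x].
Proof.
move=> fc.
have [M M0 fM] : exists2 M, 0 <= M & forall x, f x <= M * `|x|.
  have /linear_boundedP[M [_ fM]] :=
    @continuous_linear_bounded _ E R^o 0 f (fc 0).
  exists (Num.max 0 M + 1); first by rewrite addr_ge0// le_max lexx.
  move=> x; apply: le_trans (ler_norm _) _; apply: fM.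
  by rewrite ltr_pwDr// le_max lexx orbT.
have fZ t x : f (t *: x) = t * f x by rewrite linearZ.
pose C := [set u : E * R | exists y z,
  [/\ 0 <=v y, 0 <=v z & u = (y + z, f y - f z)]].
have [|||||g [g0 gM gC]] := @positive_extension M C => //.
- by exists (0 + 0, f 0 - f 0), 0, 0; split => //; exact: lev_refl.
- move=> _ _ [a [b [a0 b0 ->]]] [c [d [c0 d0 ->]]] /=.
  exists (a + c), (b + d); split; do ?exact: addv_ge0.
  rewrite addrACA; congr pair.
  by rewrite (linearD f a c) (linearD f b d) /= opprD addrACA.
- move=> t _ t0 [a [b [a0 b0 ->]]] /=.
  exists (t *: a), (t *: b); split; do ?exact: scalev_ge0.
  by rewrite scalerDr; congr pair; rewrite !fZ mulrBr.
- move=> _ [a [b [a0 b0 ->]]] /=; split; first exact: addv_ge0.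
  rewrite -linearB; apply: le_trans (fM _) _.
  by apply: ler_wpM2l => //; exact: norm_sub_le_add.
exists g; split => //; first exact: linear_bound_continuous gM.
move=> x x0; rewrite ler_norml lerNl; apply/andP; split.
  have : C (x, - f x).
    by exists 0, x; rewrite add0r linear0 sub0r; split => //; exact: lev_refl.
  exact: gC.
have : C (x, f x).
  by exists x, 0; rewrite addr0 linear0 subr0; split => //; exact: lev_refl.
exact: gC.
Qed.

End banach_lattice_functionals.

(** * Order intervals in which disjoint sequences are norm null *)

Lemma increasing_subsequence (P : nat -> Prop) :
  (forall N, exists2 n, (N <= n)%N & P n) ->
  exists k : nat -> nat, {homo k : i j / (i < j)%N} /\ forall i, P (k i).
Proof.
move=> PN; have [g gP] : {g : nat -> nat & forall N, (N <= g N)%N /\ P (g N)}.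
  apply: (@choice _ _ (fun N n => (N <= n)%N /\ P n)) => N.
  by have [n] := PN N; exists n.
exists (fun i => iter i (g \o S) (g 0%N)); split=> [|[|i]]; do ?exact: (gP _).2.
apply: homo_ltn => [? ? ?|i]; [exact: ltn_trans|exact: (gP _).1].
Qed.

Lemma not_norm_null_subsequence (K : numFieldType) (E : normedModType K)
    (x : nat -> E) : ~ norm_null x ->
  exists2 c : K, 0 < c & exists k : nat -> nat,
    {homo k : i j / (i < j)%N} /\ forall i, c <= `|x (k i)|.
Proof.
move=> x0; apply: contrapT => nc; apply: x0; apply/cvgrPdist_lt => e e0.
apply: contrapT => ne; apply: nc; exists e => //.
apply: (@increasing_subsequence (fun n => e <= `|x n|)) => N.
apply: contrapT => nN; apply: ne.
exists N => // n /= Nn; rewrite sub0r normrN real_ltNge// ?gtr0_real//.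
by apply/negP => en; apply: nN; exists n.
Qed.

(** Inverse norms along a subsequence bounded away from 0 are bounded, and bounded coefficients
    preserve nullity under homogeneous polynomials. *)
Lemma normalized_subsequence (K : numFieldType) (E : normedModType K)
    (x : nat -> E) : ~ norm_null x ->
  exists (c : nat -> K) (k : nat -> nat) (M : K),
    [/\ forall n, 0 <= c n, forall n, `|c n| <= M, forall n, (n <= k n)%N &
        forall n, `|c n *: x (k n)| = 1].
Proof.
move=> /not_norm_null_subsequence[d d0 [k [k_mono kd]]].
have xk n : 0 < `|x (k n)| := lt_le_trans d0 (kd n).
exists (fun n => `|x (k n)|^-1), k, d^-1; split => n.
- by rewrite invr_ge0.
- by rewrite normfV normr_id lef_pV2// posrE.
- elim: n => // n ih; exact: leq_ltn_trans ih (k_mono _ _ (ltnSn n)).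
- by rewrite normrZ normfV normr_id mulVf// gt_eqF.
Qed.

Section disjoint_sequences.
Context {R : realType} {E : banachLatticeType R}.
Implicit Types (w : E) (x y z : nat -> E).

(** The positive part of [a - b] lies below that of [y n - x n - (b - a)], whose norm tends to 0. *)
Lemma lev_lim x y (a b : E) : (forall n, x n <=v y n) ->
  x n @[n --> \oo] --> a -> y n @[n --> \oo] --> b -> a <=v b.
Proof.
move=> xy xa yb; apply/lev_subr_ge0; set l := b - a.
suff /eqP l0 : `|vpos (- l)| == 0.
  rewrite -oppr0 -(normr0_eq0 l0) -[X in _ <=v X]opprK.
  by apply: lev_opp2; exact: le_vpos.
rewrite eq_le normr_ge0 andbT; apply/ler_addgt0Pr => e e0; rewrite add0r.
have yxl : y n - x n @[n --> \oo] --> l by exact: cvgB.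
have /cvgrPdist_le /(_ _ e0) [N _ /(_ N (leqnn N)) /= le] := yxl.
apply: le_trans le; rewrite -[leRHS]normrN (opprB l); apply: le_trans (norm_vpos _).
apply: lev_norm_ge0; first exact: vpos_ge0.
apply: vpos_mono; rewrite -[X in X <=v _]add0r; apply: lev_add2r.
exact/lev_subr_ge0.
Qed.

Definition disjoint_null w := forall z, (forall n, 0 <=v z n) ->
  (forall n, z n <=v w) -> (forall i j, (i < j)%N -> vinf (z i) (z j) = 0) ->
  norm_null z.

(* For a fixed level jd the pieces (y_(n+1) - jd)^+ /\ (jd - y_n)^+ are disjoint in
   n, since y_m >= y_(n+1) for m > n. *)
Lemma increments_null w y : disjoint_null w -> (forall n, 0 <=v y n) ->
  (forall m n, (m <= n)%N -> y m <=v y n) -> (forall n, y n <=v w) ->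
  norm_null (fun n => y n.+1 - y n).
Proof.
move=> wnull y0 ymono yw; apply/cvgrPdist_le => e e0.
have w0 : 0 <=v w by exact: lev_trans (y0 0%N) (yw 0%N).
(* This makes the mesh [d = w / N] contribute at most [e / 2]. *)
pose N := (Num.truncn (4 * `|w| / e)).+1.
have N0 : 0 < N%:R :> R by rewrite ltr0n.
pose d := N%:R^-1 *: w.
have d0 : 0 <=v d by apply: scalev_ge0 => //; rewrite invr_ge0 ltW.
have dN : N%:R *: d = w by rewrite scalerA divff ?gt_eqF// scale1r.
have de : 2 * `|d| <= e / 2.
  rewrite normrZ gtr0_norm ?invr_gt0// mulrCA ler_pdivrMl//.
  have : 4 * `|w| / e < N%:R by exact: truncnS_gt.
  by rewrite ltr_pdivrMr// => h; lra.
pose p (j : 'I_N.+1) n :=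
  vinf (vpos (y n.+1 - j.+1%:R *: d)) (vpos (j.+1%:R *: d - y n)).
have p0 j n : 0 <=v p j n by apply/le_vinf; split; exact: vpos_ge0.
have pnull j : norm_null (p j).
  apply: wnull => [n|n|m n mn]; first exact: p0.
    apply: lev_trans (vinf_lel _ _) _; apply: vpos_le => //.
    apply: lev_trans (yw n.+1); rewrite -[X in _ <=v X]addr0.
    apply: levD (lev_refl _) _; rewrite -oppr0; apply: lev_opp2.
    exact: scalev_ge0.
  apply: (disjoint_le (p0 j m) (p0 j n) (vinf_lel _ _) (vinf_ler _ _)).
  apply: disjoint_le (vpos_disjoint (y m.+1) (j.+1%:R *: d)); do ?exact: vpos_ge0.
    exact: lev_refl.
  apply: vpos_mono; apply: levD (lev_refl _) _; apply: lev_opp2.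
  exact: ymono.
(* There are [N + 1] pieces and the grid estimate multiplies their sum by [N], so the bound [r] on
   each gives [e / 2] in total. *)
pose r := e / 2 / N%:R / N.+1%:R.
have r0 : 0 < r by rewrite !divr_gt0.
have : \forall n \near \oo, forall j, `|p j n| <= r.
  apply: filter_forall => j; have /cvgrPdist_le /(_ _ r0) := pnull j.
  by apply: filterS => n; rewrite sub0r normrN.
apply: filterS => n pr; rewrite sub0r normrN.
have := grid_estimate d0 (y0 n) (ymono _ _ (leqnSn n)).
move=> /(_ N); rewrite dN => /(_ (yw n.+1)) grid.
apply: (@le_trans _ _ `|2 *: d + N%:R *: \sum_(j < N.+1) p j n|).
  apply: lev_norm_ge0 => //; apply/lev_subr_ge0; exact: ymono.
apply: le_trans (ler_normD _ _) _; rewrite (normrZ 2) (normrZ N%:R).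
rewrite !ger0_norm// [e]splitr lerD// -ler_pdivlMl// [leRHS]mulrC.
apply: le_trans (ler_norm_sum _ _ _) _.
apply: (@le_trans _ _ (\sum_(j < N.+1) r)); first by apply: ler_sum => j _.
by rewrite sumr_const card_ord -[r *+ _]mulr_natr divfK.
Qed.

(** If the sequence were not Cauchy, some subsequence would have increments bounded below in norm,
    against [increments_null]. *)
Lemma monotone_cvg w y : disjoint_null w -> (forall n, 0 <=v y n) ->
  (forall m n, (m <= n)%N -> y m <=v y n) -> (forall n, y n <=v w) ->
  exists l : E, y n @[n --> \oo] --> l.
Proof.
move=> wnull y0 ymono yw.
suff : cvg (y n @[n --> \oo]) by move=> /cvg_ex.
apply: cauchy_cvg; apply: cauchy_exP => e e0.
apply: contrapT => nC.
have far N : exists2 n, (N <= n)%N & e <= `|y n - y N|.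
  apply: contrapT => nN; apply: nC; exists (y N); exists N => // n /= Nn.
  rewrite -ball_normE /= distrC ltNge; apply/negP => en; apply: nN.
  by exists n.
have [g gP] : {g : nat -> nat & forall N,
    (N <= g N)%N /\ e <= `|y (g N) - y N|}.
  by apply: (@choice _ _ (fun N n => (N <= n)%N /\ e <= `|y n - y N|)) => N;
    have [n] := far N; exists n.
pose k i := iter i g 0%N.
have := @increments_null w (y \o k) wnull (fun n => y0 _) _ (fun n => yw _).
have kmono : {homo k : i j / (i <= j)%N}.
  by apply: homo_leq => [//|? ? ?|i]; [exact: leq_trans|exact: (gP _).1].
move=> /(_ (fun m n mn => ymono _ _ (kmono _ _ mn))).
move=> /cvgrPdist_lt /(_ _ e0) [N _ /(_ N (leqnn N))] /=.
by rewrite sub0r normrN ltNge (gP _).2.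
Qed.

End disjoint_sequences.

Section disjointification.
Context {R : realType} {E : banachLatticeType R}.
Implicit Types (w : E) (x u z : nat -> E).

Definition positively_null x := forall f : {linear E -> R^o},
  positive_functional f -> continuous (f : E -> R) ->
  f (x n) @[n --> \oo] --> (0 : R).

(* With [f i] norming [x i] and the subsequence sparse enough, each [f i] is small
   on the later terms, hence on the supremum of the tail.  The tail suprema are
   then a decreasing sequence with increments bounded below. *)
Lemma positively_null_interval w x (c : R) : 0 < c ->
  (forall n, 0 <=v x n) -> (forall n, x n <=v w) -> (forall n, c <= `|x n|) ->
  positively_null x -> ~ disjoint_null w.
Proof.
move=> c0 x0 xw xc xnull wnull.
have [f fP] : {f : nat -> {linear E -> R^o} & forall n,
    [/\ positive_functional (f n), forall y, `|f n y| <= `|y| &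
        f n (x n) = `|x n|]}.
  by apply: (@choice _ _ (fun n (f : {linear E -> R^o}) =>
    [/\ positive_functional f, forall y, `|f y| <= `|y| &
        f (x n) = `|x n|])) => n; exact: norming_positive_functional.
have fpos n : positive_functional (f n) by have [] := fP n.
have f1 n y : `|f n y| <= `|y| by have [_ + _] := fP n; apply.
have fc n : continuous (f n : E -> R).
  by apply: (@linear_bound_continuous _ _ 1) => y; rewrite mul1r.
(* The weights with [k >= 1] sum to [c / 2], half of the lower bound on the norms. *)
pose eps k : R := c * 2^-1 ^+ k.+1.
have eps0 k : 0 < eps k by rewrite mulr_gt0// exprn_gt0// invr_gt0.
have [N NP] : {N : nat * nat -> nat & forall mk n i,
    (N mk <= n)%N -> (i <= mk.1)%N -> f i (x n) <= eps mk.2}.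
  apply: (@choice _ _ (fun mk N => forall n i,
    (N <= n)%N -> (i <= mk.1)%N -> f i (x n) <= eps mk.2)) => -[m k] /=.
  have [N _ NP] : \forall n \near \oo, forall i : 'I_m.+1, `|f i (x n)| <= eps k.
    apply: filter_forall => i.
    have /cvgrPdist_le /(_ _ (eps0 k)) := xnull _ (fpos i) (fc i).
    by apply: filterS => n; rewrite sub0r normrN.
  exists N => n i Nn im.
  by apply: le_trans (ler_norm _) _; exact: (NP n Nn (Ordinal (im : (i < m.+1)%N))).
(* Each index exceeds the previous one and is late enough for every [f i] with [i <= k j] to be at
   most [eps j.+1] from there on. *)
pose k := fix k i := if i is j.+1 then maxn (k j).+1 (N (k j, j.+1)) else 0%N.
have k_lt i : (k i < k i.+1)%N by rewrite /= leq_max leqnn.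
have k_mono : {homo k : i j / (i <= j)%N}.
  by apply: homo_leq => [//|? ? ?|i]; [exact: leq_trans|exact: ltnW].
pose u i := x (k i); pose h i := f (k i).
have hu i j : (i < j)%N -> h i (u j) <= eps j.
  case: j => // j ij; apply: (NP (k j, j.+1)); last exact: k_mono.
  by rewrite /= leq_max leqnn orbT.
(* The supremum of 0 and the terms [u i, ..., u (i + m - 1)]; its limit in [m] is the supremum [S i]
   of the tail. *)
pose T i := fix T m := if m is l.+1 then vsup (T l) (u (i + l)%N) else 0.
have T0 i m : 0 <=v T i m.
  case: m => [|m] /=; first exact: lev_refl.
  by apply: lev_trans (le_vsupr _ _); exact: x0.
have Tw i m : T i m <=v w.
  elim: m => [|m ih]; first by apply: lev_trans (xw 0%N).
  by rewrite /T /=; apply/vsup_le; split; [exact: ih|exact: xw].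
have TS i m : T i m <=v T i m.+1 by exact: le_vsupl.
have T_mono i m n : (m <= n)%N -> T i m <=v T i n.
  elim: n => [|n ih]; first by rewrite leqn0 => /eqP ->; exact: lev_refl.
  rewrite leq_eqVlt => /predU1P[->|/ih]; first exact: lev_refl.
  by move/lev_trans; apply.
have Tshift i m : T i.+1 m <=v T i m.+1.
  elim: m => [|m ih]; first exact: T0.
  by apply: vsup_mono => //; rewrite addSnnS; exact: lev_refl.
have [S SP] : {S : nat -> E & forall i, T i m @[m --> \oo] --> S i}.
  apply: (@choice _ _ (fun i (s : E) => T i m @[m --> \oo] --> s)) => i.
  exact: (monotone_cvg wnull (T0 i) (T_mono i)).
have T_le_S i m : T i m <=v S i.
  apply: (@lev_lim _ _ (fun=> T i m) (fun n => T i (m + n)%N)).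
  - by move=> n; apply: T_mono; exact: leq_addr.
  - exact: cvg_cst.
  - have := SP i; rewrite -(cvg_shiftn m (T i)).
    by under eq_fun do rewrite addnC.
have S_dec i : S i.+1 <=v S i.
  apply: (@lev_lim _ _ (T i.+1) (fun=> S i)) => [m||//].
  - by apply: lev_trans (Tshift i m) _.
  - exact: SP.
  - exact: cvg_cst.
have S_w i : S i <=v w.
  by apply: (@lev_lim _ _ (T i) (fun=> w)) (Tw i) (SP i) (cvg_cst _).
have hT i m : h i (T i.+1 m) <= c / 2 * (1 - 2^-1 ^+ m).
  elim: m => [|m ih] /=; first by rewrite linear0 expr0 subrr mulr0.
  apply: (@le_trans _ _ (h i (T i.+1 m + u (i.+1 + m)%N))).
    apply: positive_functional_le; first exact: fpos.
    apply/vsup_le; split.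
      by rewrite -[X in X <=v _]addr0; apply: levD (lev_refl _) _; exact: x0.
    by rewrite -[X in X <=v _]add0r; exact: levD (T0 _ _) (lev_refl _).
  rewrite linearD; apply: le_trans (lerD ih (hu _ _ _)) _.
    by rewrite addSn ltnS leq_addr.
  rewrite /eps; have : 2^-1 ^+ (i.+1 + m).+1 <= 2^-1 ^+ m.+2 :> R.
    by rewrite ler_wiXn2l ?invr_ge0// ?invf_le1 ?ler1n// !ltnS leq_addl.
  rewrite -(ler_pM2l c0) !exprS; move: (2^-1 ^+ m) => t; lra.
have hS i : h i (S i.+1) <= c / 2.
  have hcvg : h i (T i.+1 m) @[m --> \oo] --> h i (S i.+1).
    exact: (cvg_comp _ _ (SP i.+1) (@fc _ (S i.+1))).
  rewrite -(cvg_lim _ hcvg)//; apply: limr_le.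
    by apply/cvg_ex; eexists; exact: hcvg.
  near=> m; apply: le_trans (hT i m) _.
  by rewrite ler_piMr ?divr_ge0 ?ltW// lerBlDr lerDl exprn_ge0// invr_ge0.
have y0 i : 0 <=v w - S i by apply/lev_subr_ge0.
have yw i : w - S i <=v w.
  rewrite -[X in _ <=v X]addr0; apply: levD (lev_refl _) _.
  by rewrite -oppr0; apply: lev_opp2; exact: lev_trans (T0 i 0%N) (T_le_S i 0%N).
have y_mono i j : (i <= j)%N -> w - S i <=v w - S j.
  move: i j; apply: homo_leq => [?|? ? ?|i]; first exact: lev_refl.
    exact: lev_trans.
  by apply: levD (lev_refl _) _; exact: lev_opp2.
have c20 : 0 < c / 2 by rewrite divr_gt0.
(* The increment of [w - S i] at [m] is [S m - S (m + 1)]. Its value under [h m] is at least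
   [h m (u m) - c / 2 >= c / 2], and [h m] does not exceed the norm. *)
have /cvgrPdist_lt /(_ _ c20) [m _ /(_ m (leqnn m)) /=] :=
  increments_null wnull y0 y_mono yw.
apply/negP; rewrite -leNgt sub0r normrN.
rewrite opprD addrACA subrr add0r opprK addrC.
apply: le_trans (f1 (k m) _); apply: le_trans (ler_norm _).
rewrite linearB lerBrDr; apply: le_trans (lerD (lexx _) (hS m)) _.
rewrite -splitr; apply: le_trans (xc (k m)) _.
have [_ _ <-] := fP (k m); apply: positive_functional_le; first exact: fpos.
apply: lev_trans (T_le_S m 1%N); rewrite /T /= addn0; exact: le_vsupr.
Unshelve. all: by end_near.
Qed.

End disjointification.

(** * Extraction of disjoint sequences *)

Section disjoint_minorants.
Context {R : realType} {E : banachLatticeType R}.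
Implicit Types (w : E) (x u z : nat -> E).

(** [X] is the sum of the absolutely convergent series of the [2^-i u_i]. *)
Lemma dyadic_majorant u : (forall i, 0 <=v u i) -> (forall i, `|u i| <= 1) ->
  exists X : E, [/\ 0 <=v X, `|X| <= 2 & forall i, 2^-1 ^+ i *: u i <=v X].
Proof.
move=> u0 u1; pose v i := 2^-1 ^+ i *: u i.
have p0 i : 0 <= 2^-1 ^+ i :> R by rewrite exprn_ge0// invr_ge0.
have v0 i : 0 <=v v i by exact: scalev_ge0.
have half1 : `|2^-1| < 1 :> R by rewrite ger0_norm ?invr_ge0// invf_lt1 ?ltr1n.
have gcvg : series (geometric 1 2^-1 : nat -> R) n @[n --> \oo] --> (2 : R).
  have := @cvg_geometric_series R 1 2^-1 half1.
  by rewrite (_ : 1 / (1 - 2^-1) = 2)//; field.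
have vg n : `|v n| <= geometric 1 2^-1 n.
  by rewrite normrZ ger0_norm// /geometric /= mul1r ler_piMr.
have ncvg : cvgn [normed series v].
  apply: (@series_le_cvg _ _ (geometric 1 2^-1)) => [n|n|//|].
  - exact: normr_ge0.
  - by apply: geometric_ge0; rewrite ?invr_ge0.
  by apply/cvg_ex; eexists; exact: gcvg.
have scvg : series v n @[n --> \oo] --> limn (series v).
  exact: (normed_cvg ncvg).
exists (limn (series v)).
have v_le n m : (n <= m)%N -> series v n <=v series v m.
  by move=> nm; apply/lev_subr_ge0; rewrite sub_series_geq//; exact: sumv_ge0.
have le_lim n : series v n <=v limn (series v).
  apply: (@lev_lim _ _ (fun=> series v n) (fun m => series v (n + m)%N)).
  - by move=> m; apply: v_le; exact: leq_addr.
  - exact: cvg_cst.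
  - move: scvg; rewrite -(cvg_shiftn n (series v)).
    by under eq_fun do rewrite addnC.
split.
- by have := le_lim 0%N; rewrite /series /= big_geq.
- apply: le_trans (lim_series_norm ncvg) _.
  have -> : 2 = limn (series (geometric 1 2^-1 : nat -> R)) :> R.
    by apply/esym/cvg_lim => //; exact: gcvg.
  apply: lim_series_le => //.
  by apply/cvg_ex; eexists; exact: gcvg.
- move=> i; apply: lev_trans (le_lim i.+1); rewrite /series /= big_nat_recr//=.
  rewrite -[X in X <=v _]add0r; apply: levD (lev_refl _).
  exact: sumv_ge0.
Qed.

(** Take the positive part of [u k - B k W k - e k X], with [W k] the sum of the earlier terms. The
    term [B k W k] separates it from earlier terms and [e k X] from later ones; the latter costs at
    most 1/8 in norm. *)
Lemma disjoint_minorants u : (forall k, 0 <=v u k) -> (forall k, `|u k| <= 1) ->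
  (forall k, 4^-1 <= `|vpos (u k - (16 * 4 ^+ k) *: \sum_(i < k) u i)|) ->
  exists z, [/\ forall k, 0 <=v z k, forall k, z k <=v u k,
    forall i j, (i < j)%N -> vinf (z i) (z j) = 0 & forall k, 8^-1 <= `|z k|].
Proof.
move=> u0 u1 uW; have [X [X0 X2 uX]] := dyadic_majorant u0 u1.
pose B k : R := 16 * 4 ^+ k.
pose e k : R := 16^-1 * 2^-1 ^+ k.
have B0 k : 0 <= B k by rewrite mulr_ge0// exprn_ge0.
have p0 k : 0 < 2^-1 ^+ k :> R by rewrite exprn_gt0// invr_gt0.
have e0 k : 0 < e k by rewrite mulr_gt0// invr_gt0.
pose W k := \sum_(i < k) u i.
have W0 k : 0 <=v W k by exact: sumv_ge0.
pose a k := u k - B k *: W k.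
pose z k := vpos (a k - e k *: X).
have z_le k y : 0 <=v y -> y <=v B k *: W k + e k *: X -> z k <=v vpos (u k - y).
  move=> y0 yle; rewrite /z /a -addrA -opprD; apply: vpos_mono.
  by apply: levD (lev_refl _) _; exact: lev_opp2.
have BW0 k : 0 <=v B k *: W k by exact: scalev_ge0.
have eX0 k : 0 <=v e k *: X by apply: scalev_ge0 => //; exact: ltW.
exists z; split => [k|k|i k ik|k].
- exact: vpos_ge0.
- have := z_le k 0 (lev_refl _) (addv_ge0 (BW0 k) (eX0 k)).
  by rewrite subr0 /vpos vsup_idPl.
(* On one side [s u_k <= e_i X]; on the other [s B_k = 2^(k - i) >= 1] gives [u_i <= s B_k W_k].
   Hence [z i] and [s z k] lie below the positive and negative parts of [u i - s u k]. *)
- pose s := e i * 2^-1 ^+ k.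
  have s0 : 0 < s by exact: mulr_gt0.
  have zi : z i <=v vpos (u i - s *: u k).
    apply: z_le; first by apply: scalev_ge0; rewrite ?ltW.
    rewrite -[X in X <=v _]add0r; apply: levD (BW0 i) _.
    by rewrite -scalerA; apply: lev_scale (ltW _) (uX k).
  have sB : 1 <= s * B k.
    rewrite /s /e /B.
    have -> : 16^-1 * 2^-1 ^+ i * 2^-1 ^+ k * (16 * 4 ^+ k) =
        2^-1 ^+ i * (2^-1 ^+ k * 4 ^+ k) :> R by field.
    rewrite -exprMn (_ : 2^-1 * 4 = 2); last by field.
    rewrite -(subnK (ltnW ik)) exprD mulrCA -exprMn mulVf// expr1n mulr1.
    by rewrite exprn_ege1// ler1n.
  have zk : s *: z k <=v vpos (s *: u k - u i).
    have {1}-> : s *: z k = vpos (s *: (a k - e k *: X)) by rewrite vpos_scale ?ltW.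
    apply: vpos_mono; rewrite /a -addrA -opprD scalerBr; apply: levD (lev_refl _) _.
    apply: lev_opp2; rewrite scalerDr -[X in X <=v _]addr0; apply: levD; last first.
      by apply: scalev_ge0 (eX0 k); exact: ltW.
    apply: (@lev_trans _ _ (W k)).
      rewrite /W (bigD1 (Ordinal ik))//= -[X in X <=v _]addr0.
      by apply: levD (lev_refl _) _; exact: sumv_ge0.
    by rewrite scalerA -[X in X <=v _]scale1r; exact: lev_scale2.
  have := disjoint_le (vpos_ge0 _) (scalev_ge0 (ltW s0) (vpos_ge0 _)) zi zk
    (vpos_disjoint _ _).
  move=> /(@disjoint_scale _ _ 1 s^-1 _ _ ler01).
  rewrite scale1r scalerA mulVf ?gt_eqF// scale1r; apply.
  + by rewrite invr_ge0 ltW.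
  + exact: vpos_ge0.
  + by apply: scalev_ge0 (ltW s0) _; exact: vpos_ge0.
- have ak : vpos (a k) <=v z k + e k *: X.
    rewrite -{1}[a k](subrK (e k *: X)); apply: lev_trans (vpos_subadd _ _) _.
    by apply: levD (lev_refl _) _; rewrite /vpos vsup_idPl//; exact: lev_refl.
  have eX : `|e k *: X| <= 8^-1.
    rewrite normrZ gtr0_norm//; apply: (@le_trans _ _ (16^-1 * 2)); last by lra.
    apply: ler_pM => //; first exact: ltW.
    by rewrite /e ler_piMr// exprn_ile1// ?invr_ge0// invf_le1 ?ler1n.
  have := le_trans (uW k) (le_trans (lev_norm_ge0 (vpos_ge0 _) ak) (ler_normD _ _)).
  by move=> h; lra.
Qed.

(** Either alternative of the last clause controls positive polynomials along [z]: domination by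
    terms of [x] with indices tending to infinity, or disjointness inside an order interval. *)
Lemma disjoint_sequence x : (forall n, 0 <=v x n) -> (forall n, `|x n| = 1) ->
  positively_null x ->
  exists z (c : R), [/\ 0 < c, forall k, 0 <=v z k,
    forall i j, (i < j)%N -> vinf (z i) (z j) = 0, forall k, c <= `|z k| &
    (exists n : nat -> nat, forall k, (k <= n k)%N /\ z k <=v x (n k)) \/
    (exists w, forall k, z k <=v w)].
Proof.
move=> x0 x1 xnull.
have [big|small] := pselect (forall w N, 0 <=v w ->
    exists2 n, (N <= n)%N & 4^-1 <= `|vpos (x n - w)|).
  have [g gP] : {g : E * nat -> nat & forall wN, 0 <=v wN.1 ->
      (wN.2 <= g wN)%N /\ 4^-1 <= `|vpos (x (g wN) - wN.1)|}.
    apply: (@choice _ _ (fun wN n => 0 <=v wN.1 ->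
      (wN.2 <= n)%N /\ 4^-1 <= `|vpos (x n - wN.1)|)) => -[w N] /=.
    have [w0|w0] := pselect (0 <=v w); last by exists 0%N.
    by have [n ? ?] := big w N w0; exists n.
  pose G W k := g ((16 * 4 ^+ k) *: W, k).
  (* Each index depends on the sum of the terms already chosen, so the partial sums are built first
     and the indices read off from them. *)
  pose W := fix W k := if k is j.+1 then W j + x (G (W j) j) else 0.
  pose n k := G (W k) k; pose u k := x (n k).
  have WE k : W k = \sum_(i < k) u i.
    by elim: k => [|k ih]; rewrite ?big_ord0// big_ord_recr/= -ih.
  have W0 k : 0 <=v (16 * 4 ^+ k) *: W k.
    apply: scalev_ge0; first by rewrite mulr_ge0// exprn_ge0.
    by rewrite WE; apply: sumv_ge0 => i; exact: x0.
  have nP k := gP (_, k) (W0 k).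
  have [k|k|k|z [z0 zu zd z8]] := @disjoint_minorants u.
  - exact: x0.
  - by rewrite x1.
  - by rewrite -WE; exact: (nP k).2.
  exists z, 8^-1; split => //; left; exists n => k.
  by split; [exact: (nP k).1|exact: zu].
have [w [N [w0 wN]]] : exists w N, 0 <=v w /\
    forall n, (N <= n)%N -> `|vpos (x n - w)| < 4^-1.
  apply: contrapT => nw; apply: small => w N w0; apply: contrapT => nn.
  apply: nw; exists w, N; split => // n Nn.
  by rewrite ltNge; apply/negP => h; apply: nn; exists n.
(* Truncation by [w] removes the positive part of [x (n + N) - w], of norm below 1/4, from a unit
   vector. *)
pose y n := vinf (x (n + N)%N) w.
have y0 n : 0 <=v y n by exact/le_vinf.
have yx n : y n <=v x (n + N)%N by exact: vinf_lel.
have y_norm n : 4^-1 <= `|y n|.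
  have := wN _ (leq_addl n N); rewrite vposB_vinf => h.
  have := ler_normD (x (n + N)%N - y n) (y n); rewrite subrK x1 => h'.
  by have := lt_le_trans (ltr_leD h (lexx `|y n|)) (lexx _); lra.
have ynull : positively_null y.
  move=> f f0 fc.
  apply: (@squeeze_cvgr _ _ _ _ (fun=> 0) (fun n => f (x (n + N)%N))).
  - near=> n; rewrite f0//=; exact: positive_functional_le.
  - exact: cvg_cst.
  - rewrite (cvg_shiftn N (fun n => f (x n))); exact: xnull.
have c0 : 0 < 4^-1 :> R by rewrite invr_gt0.
have /existsNP[z] :=
  positively_null_interval c0 y0 (fun n => vinf_ler _ _) y_norm ynull.
move=> /not_implyP[z0 /not_implyP[zw /not_implyP[zd]]].
move=> /not_norm_null_subsequence[c cpos [k [k_mono kc]]].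
exists (z \o k), c; split => [//|i|i j ij|//|]; [exact: z0|exact/zd/k_mono|].
by right; exists w => i; exact: zw.
Unshelve. all: by end_near.
Qed.

End disjoint_minorants.

(** * Completeness of the scalars *)

Section complete_scalars.

(** Kept as a property of [K], so that one argument covers real and complex spaces. *)
Definition complete_scalars (K : numFieldType) :=
  forall F : set_system K, ProperFilter F -> cauchy F -> cvg F.

Lemma real_complete_scalars (R : realType) : complete_scalars R.
Proof. by move=> F FF; exact: cauchy_cvg. Qed.

Lemma normc_ge_Im (R : rcfType) (z : R[i]) : (`|complex.Im z|)%:C%C <= `|z|.
Proof. by rewrite normc_def lecR -sqrtr_sqr ler_wsqrtr// lerDr sqr_ge0. Qed.

Lemma normc_le_ReIm (R : rcfType) (z : R[i]) :
  `|z| <= (`|complex.Re z| + `|complex.Im z|)%:C%C.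
Proof.
have <- : Num.sqrt ((`|complex.Re z| + `|complex.Im z|) ^+ 2) =
    `|complex.Re z| + `|complex.Im z| by rewrite sqrtr_sqr ger0_norm ?addr_ge0.
rewrite normc_def lecR ler_wsqrtr// sqrrD !real_normK ?num_real//.
by rewrite addrAC lerDl mulrn_wge0// mulr_ge0.
Qed.

(** Real and imaginary parts are additive and do not increase absolute values, so they send a Cauchy
    filter to convergent ones. The two limits are reassembled through [normc_le_ReIm]. *)
Lemma complex_complete_scalars (R : realType) : complete_scalars R[i].
Proof.
move=> F FF /cauchy_ballP Fc.
have part (g : R[i] -> R) : (forall z w, g (z - w) = g z - g w) ->
    (forall z, (`|g z|)%:C%C <= `|z|) -> exists l : R, g @ F --> l.
  move=> gB g1; suff : cvg (g @ F) by move=> /cvg_ex.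
  apply: cauchy_cvg; apply/cauchy_ballP => e e0.
  have e0' : 0 < e%:C%C :> R[i] by rewrite ltcR.
  have [[A B] /= [FA FB] AB] := Fc _ e0'.
  exists (g @` A, g @` B).
    by split; [apply: filterS FA|apply: filterS FB] => x ? /=; exists x.
  move=> [_ _] /= [[z Az <-] [w Bw <-]].
  have := AB (z, w) (conj Az Bw); rewrite -!ball_normE /= -gB => zw.
  by rewrite -ltcR; exact: le_lt_trans (g1 _) zw.
have [a Fa] : exists a : R, (@complex.Re R) z @[z --> F] --> a.
  by apply: part => [[? ?] [? ?] //|z]; exact: normc_ge_Re.
have [b Fb] : exists b : R, (@complex.Im R) z @[z --> F] --> b.
  by apply: part => [[? ?] [? ?] //|z]; exact: normc_ge_Im.
apply/cvg_ex; exists (a +i* b)%C; apply/cvgrPdist_lt => e e0.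
have eE : e = (complex.Re e)%:C%C by rewrite RRe_real// gtr0_real.
have e20 : 0 < complex.Re e / 2 by rewrite divr_gt0// -ltcR -eE.
have /cvgrPdist_lt /(_ _ e20) Fa2 := Fa.
have /cvgrPdist_lt /(_ _ e20) Fb2 := Fb.
near=> z; apply: le_lt_trans (normc_le_ReIm _) _.
rewrite eE ltcR [ltRHS]splitr; apply: ltrD.
- have -> : complex.Re ((a +i* b)%C - z) = a - complex.Re z by case: (z).
  by near: z.
- have -> : complex.Im ((a +i* b)%C - z) = b - complex.Im z by case: (z).
  by near: z.
Unshelve. all: by end_near.
Qed.

(** Scalars whose multiples of [u] are within [e] of [v] differ by at most [2 e / |u|], so they
    generate a Cauchy filter; its limit is the coefficient. *)
Lemma line_closed (K : numFieldType) (E : normedModType K) (u v : E) :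
  complete_scalars K -> u != 0 ->
  (forall e, 0 < e -> exists a : K, `|v - a *: u| <= e) ->
  exists a : K, v = a *: u.
Proof.
move=> Kc u0 near_v.
pose F := filter_from [set e : K | 0 < e] (fun e => [set a | `|v - a *: u| <= e]).
have FF : ProperFilter F.
  apply: filter_from_proper => [|e /near_v[a ae]]; last by exists a.
  apply: filter_from_filter; first by exists 1 => /=.
  move=> d e /= d0 e0.
  have [de|/ltW ed] := real_leP (gtr0_real d0) (gtr0_real e0).
    by exists d => // a /= ad; split => //; exact: le_trans de.
  by exists e => // a /= ae; split => //; exact: le_trans ed.
have nu : 0 < `|u| by rewrite normr_gt0.
have /cvg_ex[a Fa] : cvg F.
  apply: Kc; apply: cauchy_exP => e e0.
  have e30 : 0 < e * `|u| / 3 by rewrite divr_gt0// mulr_gt0.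
  have [a ae] := near_v _ e30; exists a, (e * `|u| / 3) => //= b be.
  rewrite -ball_normE /= -(ltr_pM2r nu) -normrZ scalerBl.
  rewrite -[a *: u](subrK v) -addrA; apply: le_lt_trans (ler_normD _ _) _.
  rewrite (distrC _ v); apply: le_lt_trans (lerD ae be) _.
  rewrite -mulrDr gtr_pMr ?mulr_gt0//.
  by rewrite -mulr2n -[_ *+ 2]mulr_natl ltr_pdivrMr// mul1r ltr_nat.
have close e : 0 < e -> `|v - a *: u| <= e * (1 + `|u|).
  move=> e0; have Fe : F [set b | `|v - b *: u| <= e] by exists e.
  have [b [/= vb]] := filter_ex (filterI Fe (Fa _ (nbhsx_ballx a e e0))).
  rewrite -ball_normE /= => /ltW ab.
  rewrite -[v](subrK (b *: u)) -addrA -scalerBl.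
  apply: le_trans (ler_normD _ _) _; rewrite mulrDr mulr1 lerD//.
  by rewrite normrZ distrC ler_wpM2r.
exists a; apply/eqP; rewrite -subr_eq0; apply/negPn/negP => va.
have n0 : 0 < `|v - a *: u| by rewrite normr_gt0.
have u1 : 0 < 1 + `|u| by rewrite addr_gt0.
have e0 : 0 < `|v - a *: u| / (1 + `|u|) / 2 by rewrite !divr_gt0.
have := close _ e0; rewrite mulrAC divfK ?gt_eqF//.
by rewrite real_leNgt ?gtr0_real ?divr_gt0// ltr_pdivrMr// ltr_pMr// ltr1n.
Qed.

End complete_scalars.

(** * The space of fibrewise multiples of a sequence *)

(** The 2-adic valuation of [n + 1]. Its fibre over [i] consists of the numbers [2^i (2 N + 1) - 1],
    so all fibres are infinite. *)
Definition twopart n := logn 2 n.+1.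

Lemma twopart_infinite N i : exists2 n, (N <= n)%N & twopart n = i.
Proof.
have pos : (0 < 2 ^ i * N.*2.+1)%N by rewrite muln_gt0 expn_gt0.
exists (2 ^ i * N.*2.+1).-1; last first.
  rewrite /twopart prednK// lognM ?expn_gt0// pfactorK// logn_coprime ?addn0//.
  by rewrite coprime2n /= odd_double.
rewrite -ltnS prednK//; apply: (@leq_trans N.*2.+1).
  by rewrite ltnS -addnn leq_addr.
by rewrite leq_pmull// expn_gt0.
Qed.

Lemma twopart_sect : cancel (fun i => (2 ^ i).-1) twopart.
Proof. by move=> i; rewrite /twopart prednK ?expn_gt0// pfactorK. Qed.

Section fibrewise_multiples.
Context {K : numFieldType} {E X : normedModType K}.
Variables (ev : nat -> {linear X -> E}) (x : nat -> E).
Variables (part sect : nat -> nat).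
Hypothesis Kc : complete_scalars K.
Hypothesis ev_norm : forall n y, `|ev n y| <= `|y|.
Hypothesis x1 : forall n, `|x n| = 1.
Hypothesis sectK : cancel sect part.

(** The space [X] and its evaluations [ev] are abstract in order to cover both [c0w E] and
    [linfty E]. *)
Definition fibrewise_multiples : set X :=
  [set y | exists a : nat -> K, forall n, ev n y = a (part n) *: x n].

Lemma fibrewise_multiples_submod : submod_closed (mem fibrewise_multiples).
Proof.
split; first by rewrite inE; exists (fun=> 0) => n; rewrite linear0 scale0r.
move=> t y z; rewrite !inE => -[a ya] [b zb].
by exists (fun i => t * a i + b i) => n; rewrite linearP ya zb scalerDl scalerA.
Qed.

(** Each coordinate of a limit lies on the closed line through [x n]. Its coefficient is constant on
    fibres because those of the approximants are, and the approximation is uniform in [n]. *)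
Lemma fibrewise_multiples_closed : closed fibrewise_multiples.
Proof.
move=> y ycl.
have near_y e : 0 < e -> exists a : nat -> K,
    forall n, `|ev n y - a (part n) *: x n| <= e.
  move=> e0; have [z [[a za]]] := ycl _ (nbhsx_ballx y e e0).
  rewrite -ball_normE /= => /ltW yz; exists a => n.
  by rewrite -za -linearB; apply: le_trans (ev_norm _ _) yz.
have x0 n : x n != 0 by rewrite -normr_gt0 x1.
have [c yc] : {c : nat -> K & forall n, ev n y = c n *: x n}.
  apply: (@choice _ _ (fun n (a : K) => ev n y = a *: x n)) => n.
  apply: line_closed => // e /near_y[a ae]; by exists (a (part n)).
exists (c \o sect) => n /=; rewrite yc; congr (_ *: _).
set m := sect (part n).
apply/eqP; rewrite -subr_eq0; apply/negPn/negP => cnm.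
have d0 : 0 < `|c n - c m| by rewrite normr_gt0.
(* Approximation within a third would place [c n] and [c m] at most two thirds of their distance
   apart. *)
have d30 : 0 < `|c n - c m| / 3 by rewrite divr_gt0// ltr0n.
have [a ae] := near_y _ d30.
have cn k : part k = part n -> `|c k - a (part n)| <= `|c n - c m| / 3.
  move=> kn; apply: le_trans (ae k); rewrite yc kn -scalerBl normrZ x1 mulr1.
  exact: lexx.
have := lerD (cn n erefl) (cn m (sectK _)).
rewrite [X in _ + X]distrC => /(le_trans (ler_normD _ _)).
rewrite addrA subrK -mulr2n -[_ *+ 2]mulr_natl mulrCA ler_pMr//.
by rewrite ler_pdivlMr ?ltr0n// mul1r ler_nat.
Qed.

(** If [n] vectors spanned, expanding the multiples supported on the fibres [0, ..., n] and reading
    coordinates at [sect l] would factor the identity matrix of size [n + 1] through dimension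
    [n]. *)
Lemma fibrewise_multiples_infinite :
  (forall i, exists y, forall n, ev n y = (part n == i)%:R *: x n) ->
  infinite_dimensional fibrewise_multiples.
Proof.
move=> /choice[y yE] [n [b [bV bspan]]].
have [beta bE] : {beta : 'I_n -> nat -> K &
    forall i k, ev k (b i) = beta i (part k) *: x k}.
  by apply: (@choice _ _ (fun i a => forall k, ev k (b i) = a (part k) *: x k)).
have [C CE] : {C : nat -> 'I_n -> K &
    forall k, y k = \sum_(i < n) C k i *: b i}.
  apply: (@choice _ _ (fun k (c : 'I_n -> K) => y k = \sum_(i < n) c i *: b i)) => k.
  by apply: bspan; exists (fun l => (l == k)%:R).
pose A : 'M[K]_(n.+1, n) := \matrix_(k, i) C k i.
pose B : 'M[K]_(n, n.+1) := \matrix_(i, k) beta i k.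
suff /mulmx1_min : A *m B = 1%:M by rewrite ltnn.
apply/matrixP => k l; rewrite !mxE.
have x0 : x (sect l) != 0 by rewrite -normr_gt0 x1.
suff /eqP : (\sum_(i < n) A k i * B i l) *: x (sect l) = (k == l)%:R *: x (sect l).
  by rewrite -subr_eq0 -scalerBl scaler_eq0 (negPf x0) orbF subr_eq0 => /eqP.
have -> : (k == l) = (part (sect l) == k :> nat) by rewrite sectK eq_sym.
rewrite -yE CE.
rewrite linear_sum scaler_suml; apply: eq_bigr => i _.
by rewrite linearZ /= bE sectK scalerA !mxE.
Qed.

(** A nonzero coefficient recurs along its infinite fibre, where the norm of the coordinates is
    constant. *)
Lemma fibrewise_multiples_not_null y (a : nat -> K) :
  (forall N i, exists2 n, (N <= n)%N & part n = i) ->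
  (forall z, (forall n, ev n z = 0) -> z = 0) ->
  (forall n, ev n y = a (part n) *: x n) -> y != 0 ->
  ~ norm_null (fun n => ev n y).
Proof.
move=> part_inf ev_inj ya y0 ynull; move/eqP: y0; apply; apply: ev_inj => n.
rewrite ya; have [->|an0] := eqVneq (a (part n)) 0; first by rewrite scale0r.
have a0 : 0 < `|a (part n)| by rewrite normr_gt0.
have /cvgrPdist_lt /(_ _ a0) [N _ Nlt] := ynull.
have [m Nm mn] := part_inf N (part n).
by have := Nlt m Nm; rewrite /= sub0r normrN ya mn normrZ x1 mulr1 ltxx.
Qed.

End fibrewise_multiples.

(** * Homogeneous polynomials *)

Section homogeneous_polynomials.
Context {K : numFieldType} {E : normedModType K}.

Lemma null_scale (P : E -> K) (d : nat) (x : nat -> E) (c : nat -> K)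
    (k : nat -> nat) (M : K) : (0 < d)%N ->
  (forall t z, P (t *: z) = t ^+ d * P z) ->
  (forall n, `|c n| <= M) -> (forall n, (n <= k n)%N) ->
  P (x n) @[n --> \oo] --> (0 : K) ->
  P (c n *: x (k n)) @[n --> \oo] --> (0 : K).
Proof.
move=> d0 Phom cM kn /cvgrPdist_le Px; apply/cvgrPdist_le => e e0.
have M0 : 0 <= M := le_trans (normr_ge0 _) (cM 0%N).
(* The added 1 keeps the divisor positive when [M = 0]. *)
have M1 : 0 < M ^+ d + 1 by rewrite ltr_pwDr// exprn_ge0.
have [N _ NP] := Px _ (divr_gt0 e0 M1).
exists N => // n /= Nn; rewrite sub0r normrN Phom normrM normrX.
have := NP (k n) (leq_trans Nn (kn n)); rewrite /= sub0r normrN => Pe.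
apply: (@le_trans _ _ ((M ^+ d + 1) * (e / (M ^+ d + 1)))); last first.
  by rewrite mulrCA divff ?gt_eqF// mulr1.
apply: ler_pM => //.
by rewrite -[leLHS]addr0 lerD// lerXn2r// nnegrE.
Qed.

(** Raising [m] by one changes a single argument, so multilinear forms can be handled slot by
    slot. *)
Definition interpolate n (u v : 'I_n -> E) m : 'I_n -> E :=
  fun i => if (i < m)%N then u i else v i.

Lemma interpolateS n (u v : 'I_n -> E) (i : 'I_n) :
  interpolate u v i.+1 = [eta interpolate u v i with i |-> u i].
Proof.
apply/funext => j; rewrite /interpolate /= ltnS leq_eqVlt -val_eqE /=.
by case: eqVneq => // /val_inj ->.
Qed.

Lemma interpolate_id n (u v : 'I_n -> E) (i : 'I_n) :
  interpolate u v i = [eta interpolate u v i with i |-> v i].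
Proof.
apply/funext => j; rewrite /= -val_eqE; case: eqVneq => // /val_inj ->.
by rewrite /interpolate ltnn.
Qed.

Lemma multilinear_homogeneous n (A : ('I_n -> E) -> K) (t : K) (z : 'I_n -> E) :
  multilinear A -> A (fun i => t *: z i) = t ^+ n * A z.
Proof.
move=> Alin; pose w m := interpolate (fun i => t *: z i) z m.
have w0 : w 0%N = z by [].
have wn : w n = fun i => t *: z i.
  by apply/funext => i; rewrite /w /interpolate ltn_ord.
have A0 i y : A [eta y with i |-> 0] = 0.
  have := Alin i y 1 0 0; rewrite scaler0 addr0 mul1r => /eqP.
  by rewrite -subr_eq0 opprD addrA subrr sub0r oppr_eq0 => /eqP.
suff h m : (m <= n)%N -> A (w m) = t ^+ m * A z by rewrite -wn h.
elim: m => [|m ih mn]; first by rewrite w0 expr0 mul1r.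
pose i := Ordinal mn.
have wS : w m.+1 = [eta w m with i |-> t *: z i + 0].
  by rewrite addr0; exact: (interpolateS (fun j => t *: z j) z i).
have wm : w m = [eta w m with i |-> z i].
  by exact: interpolate_id (fun j => t *: z j) z i.
have Awm : A [eta w m with i |-> z i] = A (w m) by rewrite [in RHS]wm.
rewrite wS (Alin i (w m) t (z i) 0) (A0 i (w m)) addr0 Awm.
by rewrite (ih (ltnW mn)) exprS mulrA.
Qed.

End homogeneous_polynomials.

(** * Positive polynomials *)

Section positive_polynomials.
Context {R : realType} {E : banachLatticeType R}.

(** Replacing [u i] by [v i] in one slot adds the value of [A] with [v i - u i] in that slot, which
    is nonnegative. *)
Lemma positive_multilinear_le n (A : ('I_n -> E) -> R) (u v : 'I_n -> E) :
  multilinear A -> (forall z, (forall i, 0 <=v z i) -> 0 <= A z) ->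
  (forall i, 0 <=v u i) -> (forall i, u i <=v v i) -> A u <= A v.
Proof.
move=> Alin A0 u0 uv; pose w := interpolate v u.
have v0 i : 0 <=v v i by exact: lev_trans (u0 i) (uv i).
have wn : w n = v by apply/funext => i; rewrite /w /interpolate ltn_ord.
suff h m : (m <= n)%N -> A u <= A (w m) by rewrite -wn h.
elim: m => // m ih mn; apply: le_trans (ih (ltnW mn)) _.
pose i := Ordinal mn.
have -> : w m.+1 = [eta w m with i |-> 1 *: (v i - u i) + u i].
  by rewrite scale1r subrK; exact: (interpolateS v u i).
have wm : w m = [eta w m with i |-> u i] by exact: (interpolate_id v u i).
have Awm : A [eta w m with i |-> u i] = A (w m) by rewrite [in RHS]wm.
rewrite (Alin i (w m) 1 (v i - u i) (u i)) Awm mul1r lerDr.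
apply: A0 => j /=; case: eqP => _.
  exact/lev_subr_ge0.
by rewrite /w /interpolate; case: ifP.
Qed.

(** Finite sums of disjoint positive vectors are suprema, hence stay below [w]. The series of the
    [g (z n)] then has partial sums bounded by [g w], so its terms tend to 0. *)
Lemma disjoint_bounded_null (g : {linear E -> R^o}) (z : nat -> E) (w : E) :
  positive_functional g -> (forall n, 0 <=v z n) ->
  (forall i j, (i < j)%N -> vinf (z i) (z j) = 0) -> (forall n, z n <=v w) ->
  g (z n) @[n --> \oo] --> (0 : R).
Proof.
move=> g0 z0 zd zw; have sum_le m : \sum_(i < m) z i <=v w.
  elim: m => [|m ih].
    by rewrite big_ord0; exact: lev_trans (z0 0%N) (zw 0%N).
  rewrite big_ord_recr /= -vsup_add_vinf [vinf _ _](_ : _ = 0) ?addr0.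
    exact/vsup_le.
  apply: lev_anti; last by apply/le_vinf; split => //; exact: sumv_ge0.
  rewrite vinfC; apply: lev_trans (vinf_sum_le _ (z0 m) (fun i => z0 _)) _.
  rewrite big1 => [|i _]; first exact: lev_refl.
  by rewrite vinfC zd.
have gz0 n : 0 <= g (z n) by exact: g0.
apply: cvg_series_cvg_0; apply: nondecreasing_is_cvgn.
  by apply/nondecreasing_seqP => n; rewrite /series /= big_nat_recr//= lerDl.
exists (g w) => _ [n _ <-]; rewrite /series /= big_mkord -linear_sum.
exact: positive_functional_le.
Qed.

Lemma positive_functional_polynomial (g : {linear E -> R^o}) :
  positive_functional g -> positive_polynomial 1 (g : E -> R).
Proof.
move=> g0; exists (fun z => g (z ord0)); split => //.
- move=> i z a u v; rewrite (ord1 i) /= linearP; exact: erefl.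
- by move=> s z; congr (g (z _)); exact: ord1.
- by move=> z z0; exact: g0.
Qed.

Lemma positive_polynomial_homogeneous d (P : E -> R) (t : R) (z : E) :
  positive_polynomial d P -> P (t *: z) = t ^+ d * P z.
Proof. by move=> [A [Alin _ -> _]]; exact: multilinear_homogeneous. Qed.

(** Below terms of [x], monotonicity of the positive form suffices. Below [w], freezing all
    arguments but one at [w] bounds [P (z n)] by a positive functional, and disjointness applies. *)
Lemma positive_polynomial_minorant d (P : E -> R) (x z : nat -> E) :
  (0 < d)%N -> positive_polynomial d P -> (forall n, 0 <=v z n) ->
  (forall i j, (i < j)%N -> vinf (z i) (z j) = 0) ->
  (exists n : nat -> nat, forall k, (k <= n k)%N /\ z k <=v x (n k)) \/
    (exists w, forall k, z k <=v w) ->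
  P (x n) @[n --> \oo] --> (0 : R) -> P (z n) @[n --> \oo] --> (0 : R).
Proof.
case: d => // d _ [A [Alin _ -> A0]] z0 zd zmin Ax.
case: zmin => [[n nP]|[w zw]].
  have Axn : A (fun=> x (n k)) @[k --> \oo] --> (0 : R).
    apply/cvgrPdist_le => e e0; have /cvgrPdist_le /(_ _ e0) [N _ NP] := Ax.
    by exists N => // k Nk; apply: NP; exact: leq_trans Nk (nP k).1.
  apply: (squeeze_cvgr _ (cvg_cst 0) Axn); near=> k; rewrite A0//=.
  by apply: positive_multilinear_le => // _; exact: (nP k).2.
pose B y := A [eta (fun=> w) with ord0 |-> y].
have Blin : linear (B : E -> R^o) by move=> t y y'; rewrite /B Alin.
pose BL := GRing.isLinear.Build R E R^o *:%R B Blin.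
pose g : {linear E -> R^o} := HB.pack B BL.
have w0 : 0 <=v w by exact: lev_trans (z0 0%N) (zw 0%N).
have g0 : positive_functional g.
  by move=> y y0; apply: A0 => i /=; case: ifP.
have gz := disjoint_bounded_null g0 z0 zd zw.
apply: (squeeze_cvgr _ (cvg_cst 0) gz); near=> k; rewrite A0//=.
apply: positive_multilinear_le => // i /=; case: ifP => // _.
exact: lev_refl.
Unshelve. all: by end_near.
Qed.

(** The last clause serves weakly null sequences in degree 1 and regular polynomials in every
    degree. *)
Lemma normalized_disjoint_sequence (x : nat -> E) :
  positive_seq x -> ~ norm_null x -> positively_null x ->
  exists z : nat -> E, [/\ forall k, 0 <=v z k,
    forall i j, i <> j -> vinf (z i) (z j) = 0, forall k, `|z k| = 1 &
    forall d P, (0 < d)%N -> positive_polynomial d P ->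
      P (x n) @[n --> \oo] --> (0 : R) -> P (z n) @[n --> \oo] --> (0 : R)].
Proof.
move=> x0 /normalized_subsequence[c [k [M [c0 cM kn xc1]]]] xnull.
pose y n := c n *: x (k n).
have y0 n : 0 <=v y n by exact: scalev_ge0.
have ynull : positively_null y.
  move=> f f0 fc; apply: (@null_scale _ _ f 1 _ _ _ M) => //; last exact: xnull.
  by move=> t z; rewrite expr1; exact: linearZ.
have [z [d [d0 z0 zd zdn zmin]]] := disjoint_sequence y0 xc1 ynull.
have zn n : 0 < `|z n| := lt_le_trans d0 (zdn n).
have zi n : 0 <= `|z n|^-1 by rewrite invr_ge0.
exists (fun n => `|z n|^-1 *: z n); split => [n|i j ij|n|e P e0 Ppos Px].
- exact: scalev_ge0.
- apply: disjoint_scale => //.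
  by case: (ltngtP i j) => // [/zd//|/zd]; rewrite vinfC.
- by rewrite normrZ normfV normr_id mulVf// gt_eqF.
- have Phom := positive_polynomial_homogeneous _ _ Ppos.
  apply: (@null_scale _ _ P e z (fun n => `|z n|^-1) id d^-1) => // [n|].
    by rewrite normfV normr_id lef_pV2// posrE.
  apply: (positive_polynomial_minorant e0 Ppos z0 zd zmin).
  exact: (@null_scale _ _ P e x c k M).
Qed.

End positive_polynomials.

(** * Spaceability and latticeability *)

Section spaceability.
Context {K : supFieldType} {E : normedModType K}.

Definition linfty_eval n (y : linfty E) : E := y n.

Lemma linfty_eval_linear n : linear (linfty_eval n).
Proof. by []. Qed.

HB.instance Definition _ n := GRing.isLinear.Build K (linfty E) E *:%R
  (linfty_eval n) (linfty_eval_linear n).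

Definition c0w_eval n (y : c0w E) : E := (y : linfty E) n.

Lemma c0w_eval_linear n : linear (c0w_eval n).
Proof. by []. Qed.

HB.instance Definition _ n := GRing.isLinear.Build K (c0w E) E *:%R
  (c0w_eval n) (c0w_eval_linear n).

Lemma linfty_scaled (x : nat -> E) (a : nat -> K) (M : K) :
  (forall n, `|x n| = 1) -> (forall n, `|a n| <= M) ->
  exists y : linfty E, forall n, y n = a n *: x n.
Proof.
move=> x1 aM; have yb : (fun n => a n *: x n) \in bounded_seq E.
  by apply/bounded_seqP; exists M => n; rewrite normrZ x1 mulr1.
by exists (Linfty yb).
Qed.

Lemma coefficient_bounded (x : nat -> E) (a : nat -> K) (y : linfty E) :
  (forall n, `|x n| = 1) -> (forall n, y n = a n *: x n) ->
  forall n, `|a n| <= `|y|.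
Proof.
move=> x1 ya n; have := ler_linfty_norm y n.
by rewrite ya normrZ x1 mulr1.
Qed.

Lemma homogeneous_polynomialZ d (P : E -> K) (t : K) (z : E) :
  homogeneous_polynomial d P -> P (t *: z) = t ^+ d * P z.
Proof. by move=> [A Alin ->]; exact: multilinear_homogeneous. Qed.

Lemma polynomially_null_scale (x : nat -> E) (c : nat -> K) (k : nat -> nat)
    (M : K) : (forall n, `|c n| <= M) -> (forall n, (n <= k n)%N) ->
  polynomially_null x -> polynomially_null (fun n => c n *: x (k n)).
Proof.
move=> cM kn xnull d P d0 Phom Pc.
apply: (@null_scale _ _ P d x c k M) => //; last exact: xnull d0 Phom Pc.
by move=> t z; exact: homogeneous_polynomialZ.
Qed.

Lemma polynomially_weakly_null (x : nat -> E) :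
  polynomially_null x -> weakly_null x.
Proof.
move=> xnull f fc; apply: (xnull 1%N) => //.
exists (fun z => f (z ord0)) => // i z a u v.
by rewrite (ord1 i) /= linearP.
Qed.

Theorem spaceable_polynomially_null : complete_scalars K ->
  ~ polynomially_schur E ->
  spaceable [set x : c0w E | polynomially_null x /\ ~ norm_null x].
Proof.
move=> Kc /existsNP[x0 /not_implyP[x0null]].
move=> /normalized_subsequence[c [k [M [_ cM kn x1]]]].
pose x n := c n *: x0 (k n).
have xnull : polynomially_null x by exact: polynomially_null_scale cM kn x0null.
(* Since the [x n] are unit vectors, the coefficients of a bounded sequence are bounded. *)
have axnull (a : nat -> K) (y : linfty E) : (forall n, y n = a n *: x n) ->
    polynomially_null y.
  move=> ya; have aM := coefficient_bounded x1 ya.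
  rewrite (_ : (y : nat -> E) = fun n => a n *: x (id n)); last exact/funext.
  exact: polynomially_null_scale aM _ xnull.
have ev_norm n (y : c0w E) : `|c0w_eval n y| <= `|y|.
  exact: (ler_linfty_norm (y : linfty E)).
exists (fibrewise_multiples c0w_eval x twopart); split.
- exact: fibrewise_multiples_submod.
- exact: (fibrewise_multiples_closed Kc ev_norm x1 twopart_sect).
- apply: (fibrewise_multiples_infinite x1 twopart_sect) => i.
  have [|y yE] := @linfty_scaled x (fun n => (twopart n == i)%:R) 1 x1.
    by move=> n; case: (_ == _); rewrite ?normr1 ?normr0.
  have yc : y \in @c0w_pred K E.
    by rewrite inE; exact/polynomially_weakly_null/axnull/yE.
  by exists (C0w yc).
- move=> y [[a ya] /eqP y0]; split; first exact: (axnull _ _ ya).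
  apply: (fibrewise_multiples_not_null x1 twopart_infinite _ ya y0) => z z0.
  by apply/val_inj/val_inj/funext.
Qed.

End spaceability.

Section latticeability.
Context {R : realType} {E : banachLatticeType R}.

(** On multiples of a positive vector the lattice operations are the maximum and minimum of
    coefficients, so the fibrewise multiples form a sublattice. [Q] stands for either kind of
    nullity. *)
Lemma latticeable_multiples (z : nat -> E) (Q : (nat -> E) -> Prop) :
  (forall n, 0 <=v z n) -> (forall i j, i <> j -> vinf (z i) (z j) = 0) ->
  (forall n, `|z n| = 1) ->
  (forall a M, (forall n, `|a n| <= M) -> Q (fun n => a n *: z n)) ->
  completely_latticeable
    [set x : linfty E | [/\ disjoint_seq x, Q x & ~ norm_null x]].
Proof.
move=> z0 zd z1 Qz.
have ev_norm n (y : linfty E) : `|linfty_eval n y| <= `|y|.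
  exact: ler_linfty_norm.
exists (fibrewise_multiples linfty_eval z twopart); split.
- split; first exact: fibrewise_multiples_submod.
  move=> x y [a xa] [b yb]; split.
    exists (fun n => Num.max (a n) (b n)) => n.
    by rewrite -vsup_scale_ge0// -xa -yb.
  exists (fun n => Num.min (a n) (b n)) => n.
  by rewrite -vinf_scale_ge0// -xa -yb.
- exact: (fibrewise_multiples_closed (@real_complete_scalars R) ev_norm z1
    twopart_sect).
- apply: (fibrewise_multiples_infinite z1 twopart_sect) => i.
  apply: (@linfty_scaled _ _ z (fun n => (twopart n == i)%:R) 1 z1) => n.
  by case: (_ == _); rewrite ?normr1 ?normr0.
- move=> y [[a ya] /eqP y0]; split.
  + move=> i j ij; rewrite [y i]ya [y j]ya !modulus_scale_ge0//.
    by apply: disjoint_scale => //; exact: zd.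
  + rewrite (_ : (y : nat -> E) = fun n => a (twopart n) *: z n); last exact/funext.
    exact: (Qz _ _ (coefficient_bounded z1 ya)).
  + apply: (fibrewise_multiples_not_null z1 twopart_infinite _ ya y0) => v v0.
    exact/val_inj/funext.
Qed.

Theorem latticeable_weakly_null : ~ positive_schur E ->
  completely_latticeable
    [set x : linfty E | [/\ disjoint_seq x, weakly_null x & ~ norm_null x]].
Proof.
move=> /existsNP[x /not_implyP[x0 /not_implyP[xnull xn]]].
have [|z [z0 zd z1 zP]] := normalized_disjoint_sequence x0 xn.
  by move=> f _; exact: xnull.
apply: (latticeable_multiples z0 zd z1) => a M aM f fc.
apply: (@null_scale _ _ f 1 z a id M) => //.
  by move=> t u; rewrite expr1; exact: linearZ.
(* Only positive polynomials transfer from [x] to [z], so [f] is replaced by a positive functional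
   dominating it. *)
have [g [g0 gc fg]] := dominating_positive_functional fc.
have gz := zP _ _ (ltn0Sn 0) (positive_functional_polynomial g0) (xnull g gc).
apply/cvgrPdist_le => e e0; have /cvgrPdist_le /(_ _ e0) := gz.
apply: filterS => n; rewrite !sub0r !normrN; apply: le_trans.
by apply: le_trans (fg _ (z0 n)) _; exact: ler_norm.
Qed.

Theorem latticeable_regular_polynomially_null :
  ~ positively_polynomially_schur E ->
  completely_latticeable
    [set x : linfty E | [/\ disjoint_seq x, regular_polynomially_null x &
      ~ norm_null x]].
Proof.
move=> /existsNP[x /not_implyP[x0 /not_implyP[xnull xn]]].
(* A positive polynomial is regular, as its difference with the zero polynomial. *)
have xpos d P : (0 < d)%N -> positive_polynomial d P ->
    P (x n) @[n --> \oo] --> (0 : R).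
  move=> d0 Ppos; apply: (xnull d) => //; exists P, (fun=> 0); split => //.
    exists (fun=> 0); split => // i z a u v.
    by rewrite mulr0 addr0.
  by apply/funext => y; rewrite /= subr0.
have [|z [z0 zd z1 zP]] := normalized_disjoint_sequence x0 xn.
  move=> f f0 _; apply: xpos (ltn0Sn 0) _; exact: positive_functional_polynomial.
apply: (latticeable_multiples z0 zd z1) => a M aM d P d0 [P1 [P2 [P1pos P2pos ->]]].
have az Q : positive_polynomial d Q -> Q (a n *: z n) @[n --> \oo] --> (0 : R).
  move=> Qpos; apply: (@null_scale _ _ Q d z a id M) => //.
    by move=> t u; exact: positive_polynomial_homogeneous.
  exact: zP d0 Qpos (xpos _ _ d0 Qpos).
by rewrite -(subr0 (0 : R)); exact: cvgB (az _ P1pos) (az _ P2pos).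
Qed.

End latticeability.

(** A Banach space may be real or complex, so (a) appears once for each scalar field; Banach
    lattices are real. *)
Theorem theorem2p1 (R : realType) :
  [/\ (forall E : completeNormedModType R,
        ~ polynomially_schur E ->
        spaceable [set x : c0w E | polynomially_null x /\ ~ norm_null x]),
      (forall E : completeNormedModType R[i],
        ~ polynomially_schur E ->
        spaceable [set x : c0w E | polynomially_null x /\ ~ norm_null x]),
      (forall E : banachLatticeType R,
        ~ positive_schur E ->
        completely_latticeable
          [set x : linfty E |
            [/\ disjoint_seq x, weakly_null x & ~ norm_null x]]) &
      (forall E : banachLatticeType R,
        ~ positively_polynomially_schur E ->
        completely_latticeable
          [set x : linfty E |
            [/\ disjoint_seq x, regular_polynomially_null x &
                ~ norm_null x]])].
Proof.
split => E.
- exact: (spaceable_polynomially_null (@real_complete_scalars R)).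
- exact: (spaceable_polynomially_null (@complex_complete_scalars R)).
- exact: latticeable_weakly_null.
- exact: latticeable_regular_polynomially_null.
Qed.
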